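(* Let $0<i<j$ and let $\mathfrak{A}_i,\mathfrak{A}_j$ be two families of collections of subforests, each satisfying Assumption 1 of the context, and such that the pair satisfies Assumption 6 of the context. Then the identity $$\mathcal{M}^{(13)(2)(4)}(\Delta_i\otimes\Delta_i)\Delta_j=(\mathrm{id}\otimes\Delta_j)\Delta_i$$ holds on $\mathfrak{F}$, where $\mathcal{M}^{(13)(2)(4)}(\tau_1\otimes\tau_2\otimes\tau_3\otimes\tau_4)=(\tau_1\cdot\tau_3)\otimes\tau_2\otimes\tau_4$.
   Context: Decorated forests. $\mathbb{N}=\{0,1,2,\dots\}$; fix an integer $d\ge1$ and a finite set $\mathfrak{L}$ of types; $\mathbb{Z}(\mathfrak{L})$ is the free abelian group on $\mathfrak{L}$. A typed rooted forest $F$ is a finite, possibly empty, forest with node set $N_F$, edge set $E_F$, a distinguished root in each connected component, edges written $(x,y)$ with $x$ nearer to the root, and a type map $\mathfrak{t}:E_F\to\mathfrak{L}$. A subforest $A\subset F$ is given by $E_A\subset E_F$, $N_A\subset N_F$ with $N_A$ containing all endpoints of edges in $E_A$; subforests are disjoint ($A\cap B=\emptyset$) if their node sets are. A coloured forest is a pair $(F,\hat F)$ with $\hat F:E_F\sqcup N_F\to\mathbb{N}$ such that $\hat F(x)=\hat F(y)=\hat F(e)$ whenever $e=(x,y)\in E_F$ has $\hat F(e)\ne0$. For $i>0$, $\hat F_i$ is the subforest of nodes and edges of colour $i$. A decorated forest $(F,\hat F,\mathfrak{n},\mathfrak{o},\mathfrak{e})$ is a coloured forest with maps $\mathfrak{n}:N_F\to\mathbb{N}^d$,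 $\mathfrak{o}:N_F\to\mathbb{Z}^d\oplus\mathbb{Z}(\mathfrak{L})$ vanishing where $\hat F=0$, and $\mathfrak{e}:E_F\to\mathbb{N}^d$ vanishing where $\hat F\ne0$. Isomorphic decorated forests are identified; $\mathfrak{F}$ is the set of all of them. The forest product $\cdot$ is disjoint union. Bigrading. $|(F,\hat F,\mathfrak{n},\mathfrak{o},\mathfrak{e})|_{\mathrm{bi}}=(n_1,n_2)$ with $n_1=\sum_{e\in E_F}\sum_{l=1}^d\mathfrak{e}(e)_l$ and $n_2$ the number of nodes and edges of colour $0$ that are not roots. $\langle\mathfrak{F}\rangle$ is the space of formal series $\sum_{n\in\mathbb{N}^2}v_n$ with $v_n$ in the free real vector space $V_n$ generated by $\{\tau\in\mathfrak{F}:|\tau|_{\mathrm{bi}}=n\}$ and such that, for some $k$, $v_n=0$ whenever $n_2>k$. For two such bigraded spaces $V,W$, $V\hat\otimes W$ is the space of formal series $\sum_n u_n$ with $u_n\in\bigoplus_{m+\ell=n}V_m\otimes W_\ell$ and $u_n=0$ for $n_2$ large. All maps are extended to such series and (iterated) tensor products. Assumption 1 (for $\mathfrak{A}_i$; similarly for $\mathfrak{A}_j$). To each coloured forest $(F,\hat F)$ is associated a collection $\mathfrak{A}_i(F,\hat F)$ of subforests of $F$, compatible with isomorphisms of coloured forests, such that every $A\in\mathfrak{A}_i(F,\hat F)$ satisfies: (1) $\hat F_i\subset A$ and $\hat F_k\cap A=\emptyset$ for every $k>i$; (2) for every $0<k<i$ and every connected component $T$ of $\hat F_k$, either $T\subset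 A$ or $T\cap A=\emptyset$. Write $\hat F\restriction A$ for the restriction of $\hat F$ to $A$ and $\hat F\cup_iA$ for the colouring equal to $i$ on $N_A\sqcup E_A$ and to $\hat F$ elsewhere. Assumption 6. For every coloured forest $(F,\hat F)$ one has [$A\in\mathfrak{A}_i(F,\hat F)$ and $B\in\mathfrak{A}_j(F,\hat F\cup_iA)$] if and only if [$B\in\mathfrak{A}_j(F,\hat F)$ and $A\in\mathfrak{A}_i(F,\hat F\cup_jB)\sqcup\mathfrak{A}_i(B,\hat F\restriction B)$], where $\mathfrak{A}\sqcup\bar{\mathfrak{A}}=\{A\sqcup\bar A:A\in\mathfrak{A},\bar A\in\bar{\mathfrak{A}}\}$. The map $\Delta_i:\langle\mathfrak{F}\rangle\to\langle\mathfrak{F}\rangle\hat\otimes\langle\mathfrak{F}\rangle$ (and similarly $\Delta_j$) is given on $\tau=(F,\hat F,\mathfrak{n},\mathfrak{o},\mathfrak{e})$ by $$\Delta_i\tau=\sum_{A\in\mathfrak{A}_i(F,\hat F)}\sum_{\varepsilon,\mathfrak{n}_A}\frac{1}{\varepsilon!}\binom{\mathfrak{n}}{\mathfrak{n}_A}(A,\hat F\restriction A,\mathfrak{n}_A+\pi\varepsilon,\mathfrak{o}\restriction N_A,\mathfrak{e}\restriction E_A)\otimes(F,\hat F\cup_iA,\mathfrak{n}-\mathfrak{n}_A,\mathfrak{o}+\mathfrak{n}_A+\pi(\varepsilon-\mathfrak{e}\mathbf{1}_{E_A}),\mathfrak{e}\mathbf{1}_{E_F\setminus E_A}+\varepsilon),$$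 where $\mathfrak{n}_A$ runs over maps $N_F\to\mathbb{N}^d$ supported in $N_A$, $\varepsilon$ over maps $E_F\to\mathbb{N}^d$ supported in $\{(x,y)\in E_F\setminus E_A:x\in N_A\}$, $(\pi\varepsilon)(x)=\sum_{e=(x,y)\in E_F}\varepsilon(e)$, and factorials and binomial coefficients are products over all nodes/edges and components (a binomial coefficient vanishes unless $0\le\mathfrak{n}_A\le\mathfrak{n}$). *)

(* Defs.v *)
From HB Require Import structures.
From mathcomp Require Import all_boot all_order all_algebra.
From mathcomp Require Import mathcomp_extra boolp classical_sets functions.
From mathcomp Require Import cardinality fsbigop reals.

Set Implicit Arguments.
Unset Strict Implicit.
Unset Printing Implicit Defensive.

Import Order.TTheory GRing.Theory Num.Theory.

Local Open Scope ring_scope.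
Local Open Scope quotient_scope.

Definition edge_rel (N E : finType) (s t : E -> N) : rel N :=
  fun x y => [exists e, (s e == x) && (t e == y)].

(* A rooted forest is encoded by orienting every edge [(src e, tgt e)] away
   from the root of its component: every node is the target of at most one
   edge, and there is no directed cycle. The roots are then the nodes that are
   the target of no edge, and each connected component has exactly one. *)
Record forest (L N E : finType) : Type := Forest {
  src : E -> N;
  tgt : E -> N;
  typ : E -> L;
  tgt_inj : injective tgt;
  acyclic : forall e, ~~ connect (edge_rel src tgt) (tgt e) (src e) }.

Definition is_root (L N E : finType) (F : forest L N E) (x : N) : bool :=
  [forall e, tgt F e != x].

Definition subforest (L N E : finType) (F : forest L N E) : finType :=
  {A : {set N} * {set E} |
    [forall e in A.2, (src F e \in A.1) && (tgt F e \in A.1)]}.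

Section Subforest.
Variables (L N E : finType) (F : forest L N E).
Implicit Types A B T : subforest F.

Definition snodes A : {set N} := (sval A).1.
Definition sedges A : {set E} := (sval A).2.

Lemma src_sub A e : e \in sedges A -> src F e \in snodes A.
Proof. by move: (svalP A) => /forall_inP h /h /andP[]. Qed.

Lemma tgt_sub A e : e \in sedges A -> tgt F e \in snodes A.
Proof. by move: (svalP A) => /forall_inP h /h /andP[]. Qed.

Definition sub_le A B : Prop :=
  (snodes A \subset snodes B) /\ (sedges A \subset sedges B).

Definition sub_disjoint A B : Prop := [disjoint snodes A & snodes B].

Lemma sub_union_subproof A B :
  [forall e in (snodes A :|: snodes B, sedges A :|: sedges B).2,
    (src F e \in (snodes A :|: snodes B, sedges A :|: sedges B).1) &&
    (tgt F e \in (snodes A :|: snodes B, sedges A :|: sedges B).1)].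
Proof.
apply/forall_inP => e /=; rewrite !inE => /orP[] h.
  by rewrite (src_sub h) (tgt_sub h).
by rewrite (src_sub h) (tgt_sub h) !orbT.
Qed.

Definition sub_union A B : subforest F :=
  exist _ (snodes A :|: snodes B, sedges A :|: sedges B) (sub_union_subproof A B).

Definition adjacent A : rel N := fun x y =>
  [exists e in sedges A,
    ((src F e == x) && (tgt F e == y)) || ((src F e == y) && (tgt F e == x))].

(* the connected component of the node [x] of [A] *)
Definition component_set A (x : N) : {set N} * {set E} :=
  ([set y | connect (adjacent A) x y],
   [set e in sedges A | connect (adjacent A) x (src F e)]).

Lemma component_subproof A x :
  [forall e in (component_set A x).2,
    (src F e \in (component_set A x).1) && (tgt F e \in (component_set A x).1)].
Proof.
apply/forall_inP => e /=; rewrite !inE => /andP[eA xe]; rewrite xe /=.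
apply: (connect_trans xe); apply: connect1; apply/existsP; exists e.
by rewrite eA !eqxx.
Qed.

Definition component A (x : N) : subforest F :=
  exist _ (component_set A x) (component_subproof A x).

Definition is_component A T : Prop :=
  exists2 x, x \in snodes A & T = component A x.

End Subforest.

Record cforest (L N E : finType) : Type := CForest {
  uncol :> forest L N E;
  ncol : N -> nat;
  ecol : E -> nat;
  col_ok : forall e, ecol e != 0%N ->
    ncol (src uncol e) = ecol e /\ ncol (tgt uncol e) = ecol e }.

Record cforest_iso (L N E N' E' : finType) (F : cforest L N E)
    (F' : cforest L N' E') (f : N -> N') (g : E -> E') : Prop := CForestIso {
  iso_nodes : bijective f;
  iso_edges : bijective g;
  iso_src : forall e, src F' (g e) = f (src F e);
  iso_tgt : forall e, tgt F' (g e) = f (tgt F e);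
  iso_typ : forall e, typ F' (g e) = typ F e;
  iso_ncol : forall x, ncol F' (f x) = ncol F x;
  iso_ecol : forall e, ecol F' (g e) = ecol F e }.

Section Coloured.
Variables (L N E : finType) (F : cforest L N E).

Lemma colour_sub_subproof (k : nat) :
  [forall e in ([set x | (0 < k)%N && (ncol F x == k)],
                [set e | (0 < k)%N && (ecol F e == k)]).2,
    (src F e \in ([set x | (0 < k)%N && (ncol F x == k)],
                [set e | (0 < k)%N && (ecol F e == k)]).1) &&
    (tgt F e \in ([set x | (0 < k)%N && (ncol F x == k)],
                [set e | (0 < k)%N && (ecol F e == k)]).1)].
Proof.
apply/forall_inP => e /=; rewrite !inE => /andP[k0 /eqP ek].
have e0 : ecol F e != 0%N by rewrite ek -lt0n.
by have [-> ->] := col_ok e0; rewrite ek k0 eqxx.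
Qed.

(* The nodes and edges of colour [k > 0]; for [k = 0], where these need not
   form a subforest, it is empty. *)
Definition colour_sub (k : nat) : subforest F :=
  exist _ ([set x | (0 < k)%N && (ncol F x == k)],
           [set e | (0 < k)%N && (ecol F e == k)]) (colour_sub_subproof k).

Definition admissible (i : nat) (A : subforest F) : Prop :=
  [/\ sub_le (colour_sub i) A,
      forall k, (i < k)%N -> sub_disjoint (colour_sub k) A &
      forall k, (0 < k < i)%N -> forall T, is_component (colour_sub k) T ->
        sub_le T A \/ sub_disjoint T A].

Lemma admissible_edge i A e : admissible i A -> ecol F e != 0%N ->
  src F e \in snodes A \/ tgt F e \in snodes A -> e \in sedges A.
Proof.
move=> [[_ /fintype.subsetP hE] hgt hlt] e0 hA.
have [cs ct] := col_ok e0.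
have eF : e \in sedges (colour_sub (ecol F e)) by rewrite inE lt0n e0 eqxx.
have [lt_i|gt_i|eq_i] := ltngtP (ecol F e) i.
- have k0 : (0 < ecol F e < i)%N by rewrite lt0n e0.
  pose T := component (colour_sub (ecol F e)) (src F e).
  have cT : is_component (colour_sub (ecol F e)) T.
    by exists (src F e) => //; apply: src_sub.
  have eT : e \in sedges T by rewrite inE eF connect0.
  have [[_ /fintype.subsetP/(_ _ eT)//]|dT] := hlt _ k0 _ cT.
  case: hA => hA.
    by have := disjointFr dT (src_sub eT); rewrite hA.
  by have := disjointFr dT (tgt_sub eT); rewrite hA.
- have dT := hgt _ gt_i.
  case: hA => hA.
    by have := disjointFr dT (src_sub eF); rewrite hA.
  by have := disjointFr dT (tgt_sub eF); rewrite hA.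
- by apply: hE; rewrite -eq_i.
Qed.

Section Recolour.
Variables (i : nat) (A : subforest F) (hA : admissible i A).

Definition recol_node (x : N) : nat := if x \in snodes A then i else ncol F x.
Definition recol_edge (e : E) : nat := if e \in sedges A then i else ecol F e.

Lemma recol_subproof e : recol_edge e != 0%N ->
  recol_node (src F e) = recol_edge e /\ recol_node (tgt F e) = recol_edge e.
Proof.
rewrite /recol_edge /recol_node; case: (boolP (e \in sedges A)) => eA.
  by rewrite (src_sub eA) (tgt_sub eA).
move=> e0; have [-> ->] := col_ok e0.
case: ifP => [h|_]; first by rewrite (admissible_edge hA e0 (or_introl h)) in eA.
case: ifP => [h|_] //.
by rewrite (admissible_edge hA e0 (or_intror h)) in eA.
Qed.

Definition recol : cforest L N E := CForest recol_subproof.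

End Recolour.
End Coloured.

Lemma connect_pull (N E N' E' : finType) (s t : E -> N) (s' t' : E' -> N')
    (h : N' -> N) (k : E' -> E) :
  (forall e, s (k e) = h (s' e)) -> (forall e, t (k e) = h (t' e)) ->
  forall x y, connect (edge_rel s' t') x y -> connect (edge_rel s t) (h x) (h y).
Proof.
move=> hs ht x y /connectP[p + ->]; elim: p x => [|z p IH] x /=.
  by rewrite connect0.
move=> /andP[/existsP[e /andP[/eqP <- /eqP <-]] /IH]; apply: connect_trans.
by apply: connect1; apply/existsP; exists (k e); rewrite hs ht !eqxx.
Qed.

Lemma acyclic_pull (N E N' E' : finType) (s t : E -> N) (s' t' : E' -> N')
    (h : N' -> N) (k : E' -> E) :
  (forall e, s (k e) = h (s' e)) -> (forall e, t (k e) = h (t' e)) ->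
  (forall e, ~~ connect (edge_rel s t) (t e) (s e)) ->
  forall e, ~~ connect (edge_rel s' t') (t' e) (s' e).
Proof.
move=> hs ht hac e; apply: contra (hac (k e)).
by rewrite hs ht; apply: connect_pull.
Qed.

Section Restrict.
Variables (L N E : finType) (F : forest L N E) (A : subforest F).

Definition sub_node : finType := {x : N | x \in snodes A}.
Definition sub_edge : finType := {e : E | e \in sedges A}.

Definition restr_src (e : sub_edge) : sub_node :=
  exist _ (src F (sval e)) (src_sub (svalP e)).
Definition restr_tgt (e : sub_edge) : sub_node :=
  exist _ (tgt F (sval e)) (tgt_sub (svalP e)).

Lemma restr_tgt_inj : injective restr_tgt.
Proof. by move=> e e' [] /tgt_inj /val_inj. Qed.

Lemma restr_acyclic e :
  ~~ connect (edge_rel restr_src restr_tgt) (restr_tgt e) (restr_src e).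
Proof.
exact: (@acyclic_pull _ _ _ _ (src F) (tgt F) _ _
  (fun x : sub_node => sval x) (fun e : sub_edge => sval e)) (acyclic F) e.
Qed.

Definition restr_forest : forest L sub_node sub_edge :=
  Forest (fun e : sub_edge => typ F (sval e)) restr_tgt_inj restr_acyclic.

(* a subforest of the forest [A], seen as a subforest of [F] *)
Definition embed_set (B : subforest restr_forest) : {set N} * {set E} :=
  ([set sval x | x in snodes B], [set sval e | e in sedges B]).

Lemma embed_subproof (B : subforest restr_forest) :
  [forall e in (embed_set B).2,
    (src F e \in (embed_set B).1) && (tgt F e \in (embed_set B).1)].
Proof.
apply/forall_inP => _ /imsetP[e eB ->] /=; apply/andP; split; apply/imsetP.
  by exists (restr_src e) => //; exact: (src_sub eB).
by exists (restr_tgt e) => //; exact: (tgt_sub eB).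
Qed.

Definition embed (B : subforest restr_forest) : subforest F :=
  exist _ (embed_set B) (embed_subproof B).

End Restrict.

Section RestrictColoured.
Variables (L N E : finType) (F : cforest L N E) (A : subforest F).

Lemma restr_col_subproof (e : sub_edge A) : ecol F (sval e) != 0%N ->
  ncol F (sval (src (restr_forest A) e)) = ecol F (sval e) /\
  ncol F (sval (tgt (restr_forest A) e)) = ecol F (sval e).
Proof. exact: col_ok. Qed.

Definition restr : cforest L (sub_node A) (sub_edge A) :=
  @CForest L (sub_node A) (sub_edge A) (restr_forest A)
    (fun x => ncol F (sval x)) (fun e => ecol F (sval e)) restr_col_subproof.

End RestrictColoured.

Arguments restr {L N E} F A.

Definition sub_family (L : finType) : Type :=
  forall (N E : finType) (F : cforest L N E), {set subforest F}.

Record assumption1 (L : finType) (i : nat) (U : sub_family L) : Prop :=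
    Assumption1 {
  a1_iso : forall (N E N' E' : finType) (F : cforest L N E)
      (F' : cforest L N' E') (f : N -> N') (g : E -> E'),
    cforest_iso F F' f g ->
    forall (A : subforest F) (A' : subforest F'),
      snodes A' = f @: snodes A -> sedges A' = g @: sedges A ->
      (A' \in U N' E' F') = (A \in U N E F);
  a1_adm : forall (N E : finType) (F : cforest L N E) (A : subforest F),
    A \in U N E F -> admissible i A }.

(* The second occurrence of [Ui] below is evaluated on the coloured forest [B];
   its elements are transported to [F] by [embed]. The union is automatically
   disjoint: the elements of [Ui] at the recoloured forest do not meet the nodes
   of [B], which have colour [j > i] there. *)
Definition assumption6 (L : finType) (i j : nat) (Ui Uj : sub_family L)
    (hi : assumption1 i Ui) (hj : assumption1 j Uj) : Prop :=
  forall (N E : finType) (F : cforest L N E) (A B : subforest F),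
    (exists hA : A \in Ui N E F, B \in Uj N E (recol (a1_adm hi hA)))
    <->
    (exists hB : B \in Uj N E F,
      A \in [set sub_union (A1 : subforest F) (embed A2)
              | A1 in Ui N E (recol (a1_adm hj hB)),
                A2 in Ui _ _ (restr F B)]).

Notation Ndec d := {ffun 'I_d -> nat}.
Notation Zdec L d := ({ffun 'I_d -> int} * {ffun L -> int})%type.

(* the inclusions of Z^d in Z^d + Z(L), and of N^d in Z^d *)
Definition Zdec_of_Z (L : finType) (d : nat) (v : {ffun 'I_d -> int}) : Zdec L d :=
  (v, 0).
Definition Z_of_N (d : nat) (v : Ndec d) : {ffun 'I_d -> int} :=
  [ffun l => (v l)%:Z].

Record dforest (L : finType) (d : nat) (N E : finType) : Type := DForest {
  undec :> cforest L N E;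
  ndec : N -> Ndec d;
  odec : N -> Zdec L d;
  edec : E -> Ndec d;
  odec_ok : forall x, ncol undec x = 0%N -> odec x = 0;
  edec_ok : forall e, ecol undec e != 0%N -> edec e = 0 }.

Definition dforest_iso (L : finType) (d : nat) (N E N' E' : finType)
    (D : dforest L d N E) (D' : dforest L d N' E') : Prop :=
  exists (f : N -> N') (g : E -> E'),
    [/\ cforest_iso D D' f g,
        forall x, ndec D' (f x) = ndec D x,
        forall x, odec D' (f x) = odec D x &
        forall e, edec D' (g e) = edec D e].

Section IsoEquiv.
Variables (L : finType) (d : nat).

Lemma dforest_iso_refl (N E : finType) (D : dforest L d N E) : dforest_iso D D.
Proof. by exists id, id; split=> //; split=> //; exists id. Qed.

Lemma dforest_iso_sym (N E N' E' : finType) (D : dforest L d N E)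
  (D' : dforest L d N' E') : dforest_iso D D' -> dforest_iso D' D.
Proof.
move=> [f [g [[[f' fK f'K] [g' gK g'K] hs ht hty hn he] hnd hod hed]]].
exists f', g'; split.
- split.
  + by exists f.
  + by exists g.
  + by move=> e; rewrite -{2}(g'K e) hs fK.
  + by move=> e; rewrite -{2}(g'K e) ht fK.
  + by move=> e; rewrite -{2}(g'K e) hty.
  + by move=> x; rewrite -{2}(f'K x) hn.
  + by move=> e; rewrite -{2}(g'K e) he.
- by move=> x; rewrite -{2}(f'K x) hnd.
- by move=> x; rewrite -{2}(f'K x) hod.
- by move=> x; rewrite -{2}(g'K x) hed.
Qed.

Lemma dforest_iso_trans (N E N' E' N'' E'' : finType) (D : dforest L d N E)
  (D' : dforest L d N' E') (D'' : dforest L d N'' E'') :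
  dforest_iso D D' -> dforest_iso D' D'' -> dforest_iso D D''.
Proof.
move=> [f [g [[bf bg hs ht hty hn he] hnd hod hed]]].
move=> [f1 [g1 [[bf1 bg1 hs1 ht1 hty1 hn1 he1] hnd1 hod1 hed1]]].
exists (f1 \o f), (g1 \o g); split => [|x|x|x] /=.
- split=> [||e|e|e|x|e] /=.
  + exact: bij_comp.
  + exact: bij_comp.
  + by rewrite hs1 hs.
  + by rewrite ht1 ht.
  + by rewrite hty1 hty.
  + by rewrite hn1 hn.
  + by rewrite he1 he.
- by rewrite hnd1 hnd.
- by rewrite hod1 hod.
- by rewrite hed1 hed.
Qed.

(* Every finite forest is isomorphic to one whose nodes and edges are labelled
   by initial segments of N, so isomorphism classes are formed on these. *)
Record std_dforest : Type := StdDForest {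
  std_n : nat;
  std_m : nat;
  std_val :> dforest L d 'I_std_n 'I_std_m }.

HB.instance Definition _ := gen_eqMixin std_dforest.
HB.instance Definition _ := gen_choiceMixin std_dforest.

Definition std_iso (D D' : std_dforest) : bool := `[< dforest_iso D D' >].

Lemma std_iso_refl : reflexive std_iso.
Proof. by move=> D; apply/asboolP; exact: dforest_iso_refl. Qed.

Lemma std_iso_sym : symmetric std_iso.
Proof.
by move=> D D'; apply/asboolP/asboolP; exact: dforest_iso_sym.
Qed.

Lemma std_iso_trans : transitive std_iso.
Proof.
move=> D' D D'' /asboolP h /asboolP h'; apply/asboolP.
exact: dforest_iso_trans h h'.
Qed.

Canonical std_iso_equiv := EquivRel std_iso std_iso_refl std_iso_sym std_iso_trans.

Definition decforest : Type := {eq_quot std_iso}.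
HB.instance Definition _ := Choice.on decforest.

Section Std.
Variables (N E : finType) (D : dforest L d N E).
Let n := #|N|.
Let m := #|E|.

Definition std_src (e : 'I_m) : 'I_n := enum_rank (src D (enum_val e)).
Definition std_tgt (e : 'I_m) : 'I_n := enum_rank (tgt D (enum_val e)).

Lemma std_tgt_inj : injective std_tgt.
Proof. by move=> e e' /enum_rank_inj /tgt_inj /enum_val_inj. Qed.

Lemma std_acyclic e : ~~ connect (edge_rel std_src std_tgt) (std_tgt e) (std_src e).
Proof.
apply: (@acyclic_pull _ _ _ _ (src D) (tgt D) _ _
  (fun x : 'I_n => enum_val x) (fun e : 'I_m => enum_val e)) => [{}e|{}e|].
- by rewrite enum_rankK.
- by rewrite enum_rankK.
- exact: acyclic.
Qed.

Definition std_forest : forest L 'I_n 'I_m :=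
  Forest (fun e => typ D (enum_val e)) std_tgt_inj std_acyclic.

Lemma std_col_ok (e : 'I_m) : ecol D (enum_val e) != 0%N ->
  ncol D (enum_val (src std_forest e)) = ecol D (enum_val e) /\
  ncol D (enum_val (tgt std_forest e)) = ecol D (enum_val e).
Proof. by rewrite !enum_rankK; exact: col_ok. Qed.

Definition std_cforest : cforest L 'I_n 'I_m :=
  @CForest L 'I_n 'I_m std_forest (fun x => ncol D (enum_val x))
    (fun e => ecol D (enum_val e)) std_col_ok.

Definition std : std_dforest :=
  StdDForest (@DForest L d 'I_n 'I_m std_cforest
    (fun x => ndec D (enum_val x)) (fun x => odec D (enum_val x))
    (fun e => edec D (enum_val e))
    (fun x => @odec_ok _ _ _ _ D (enum_val x))
    (fun e => @edec_ok _ _ _ _ D (enum_val e))).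

Lemma std_isoP : dforest_iso D std.
Proof.
exists enum_rank, enum_rank; split=> [|x|x|x] /=; rewrite ?enum_rankK //.
split=> [||e|e|e|x|e] /=; rewrite /std_src /std_tgt ?enum_rankK //.
Qed.

Definition iso_class : decforest := \pi_decforest std.

End Std.

Lemma iso_class_repr (N E : finType) (D : dforest L d N E) :
  dforest_iso D (repr (iso_class D)).
Proof.
apply: (dforest_iso_trans (std_isoP D)); apply/asboolP.
suff : std D = repr (iso_class D) %[mod decforest] by move/eqmodP.
by rewrite reprK.
Qed.

Lemma iso_classP (N E N' E' : finType) (D : dforest L d N E)
    (D' : dforest L d N' E') :
  iso_class D = iso_class D' <-> dforest_iso D D'.
Proof.
split=> [h|h].
  apply: (dforest_iso_trans (iso_class_repr D)); rewrite h.
  exact: dforest_iso_sym (iso_class_repr D').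
apply/eqmodP; apply/asboolP.
apply: (dforest_iso_trans (dforest_iso_sym (std_isoP D))).
exact: (dforest_iso_trans h (std_isoP D')).
Qed.

End IsoEquiv.

HB.mixin Record isBigraded (T : Type) := { bideg : T -> nat * nat }.

#[short(type="bigradedType")]
HB.structure Definition Bigraded := { T of Choice T & isBigraded T }.

Section BigradedProd.
Variables X Y : bigradedType.

Definition prod_bideg (z : X * Y) : nat * nat :=
  ((bideg z.1).1 + (bideg z.2).1, (bideg z.1).2 + (bideg z.2).2)%N.

HB.instance Definition _ := isBigraded.Build (X * Y)%type prod_bideg.

End BigradedProd.

(* For a basis [X] whose elements carry a bidegree, [series R X] is the space of
   formal series [sum_n v_n], with [v_n] in the real vector space freely
   generated by the elements of bidegree [n] and with [v_n = 0] for [n.2] large;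
   a series is given by its coefficients on [X]. As the tensor product of two
   free spaces is free on the product of the bases, the completed tensor product
   of [series R X] and [series R Y] is [series R (X * Y)]. *)
Record series (R : realType) (X : bigradedType) : Type := Series {
  coef :> X -> R;
  coef_fin : forall n, finite_set [set x | bideg x = n /\ coef x != 0]%classic;
  coef_bnd : exists k : nat, forall x, coef x != 0 -> ((bideg x).2 <= k)%N }.

Lemma seriesP (R : realType) (X : bigradedType) (v w : series R X) :
  v =1 w -> v = w.
Proof.
case: v w => [v v1 v2] [w w1 w2] /= /funext vw; case: _ / vw w1 w2 => w1 w2.
by congr Series; exact: Prop_irrelevance.
Qed.

Definition tri (p q : nat * nat) : bool := ((p.1 <= q.1) && (q.2 <= p.2))%N.

(* The values on basis elements of a linear map that is triangular for the
   bigrading; such maps are the ones that extend to formal series. *)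
Record tmap (R : realType) (X Y : bigradedType) : Type := TMap {
  tval :> X -> series R Y;
  tvalP : forall x y, tval x y != 0 -> tri (bideg x) (bideg y) }.

Section Series.
Variable R : realType.

Section Basis.
Variable X : bigradedType.
Variable x : X.

Lemma basis_fin n : finite_set [set y | bideg y = n /\ (x == y)%:R != 0 :> R]%classic.
Proof.
apply: (sub_finite_set _ (finite_set1 x)) => y /= [_].
by case: (x =P y) => [->|_] //; rewrite eqxx.
Qed.

Lemma basis_bnd :
  exists k : nat, forall y, (x == y)%:R != 0 :> R -> ((bideg y).2 <= k)%N.
Proof.
exists (bideg x).2 => y.
by case: (x =P y) => [->|_] //; rewrite eqxx.
Qed.

Definition basis : series R X :=
  @Series R X (fun y => (x == y)%:R) basis_fin basis_bnd.

End Basis.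

(* the linear map sending each basis element [x] to the basis element [h x] *)
Section Pure.
Variables (X Y : bigradedType) (h : X -> Y).
Hypothesis h_tri : forall x, tri (bideg x) (bideg (h x)).

Lemma pure_tri x y : basis (h x) y != 0 -> tri (bideg x) (bideg y).
Proof. by rewrite /=; case: (h x =P y) => [<-|_] //; rewrite eqxx. Qed.

Definition pure : tmap R X Y := TMap pure_tri.

End Pure.

Lemma tri_refl p : tri p p. Proof. by rewrite /tri !leqnn. Qed.

Definition tid (X : bigradedType) : tmap R X X :=
  @pure X X id (fun x => tri_refl (bideg x)).

Section Tensor.
Variables (X X' Y Y' : bigradedType) (f : tmap R X Y) (g : tmap R X' Y').

Section At.
Variable x : X * X'.

Lemma tensor_fin n : finite_set
  [set y : Y * Y' | bideg y = n /\ f x.1 y.1 * g x.2 y.2 != 0]%classic.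
Proof.
pose B (p : nat * nat) : set (nat * nat) := [set q | (q.1 <= p.1)%N /\ (q.2 <= p.2)%N]%classic.
have finB p : finite_set (B p).
  apply: (sub_finite_set _ (finite_setX (finite_II p.1.+1) (finite_II p.2.+1))).
  by move=> q [] /=; rewrite !ltnS.
pose S := (\bigcup_(q in B n) [set y | bideg y = q /\ f x.1 y != 0])%classic.
pose S' := (\bigcup_(q in B n) [set y | bideg y = q /\ g x.2 y != 0])%classic.
have fS : finite_set S by apply: bigcup_finite => // q _; exact: coef_fin.
have fS' : finite_set S' by apply: bigcup_finite => // q _; exact: coef_fin.
apply: (sub_finite_set _ (finite_setX fS fS')) => -[y y'] /= [yn].
rewrite mulf_eq0 negb_or => /andP[hy hy']; split => /=.
  by exists (bideg y) => //; rewrite -yn; split => /=; exact: leq_addr.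
by exists (bideg y') => //; rewrite -yn; split => /=; exact: leq_addl.
Qed.

Lemma tensor_bnd : exists k : nat, forall y : Y * Y',
  f x.1 y.1 * g x.2 y.2 != 0 -> ((bideg y).2 <= k)%N.
Proof.
have [k hk] := coef_bnd (f x.1); have [k' hk'] := coef_bnd (g x.2).
exists (k + k')%N => -[y y'] /=; rewrite mulf_eq0 negb_or => /andP[/hk h /hk' h'].
exact: leq_add.
Qed.

Definition tensor_at : series R (Y * Y')%type :=
  @Series R (Y * Y')%type (fun y => f x.1 y.1 * g x.2 y.2) tensor_fin tensor_bnd.

End At.

Lemma tensor_tri (x : X * X') (y : Y * Y') :
  tensor_at x y != 0 -> tri (bideg x) (bideg y).
Proof.
rewrite /= mulf_eq0 negb_or => /andP[/tvalP/andP[h1 h2] /tvalP/andP[h3 h4]].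
by rewrite /tri !leq_add.
Qed.

Definition tensor : tmap R (X * X')%type (Y * Y')%type := TMap tensor_tri.

End Tensor.

Section Extend.
Variables (X Y : bigradedType) (f : tmap R X Y) (v : series R X).

Definition extend_coef (y : Y) : R :=
  \sum_(x \in [set: X]%classic) v x * f x y.

Lemma extend_coefN0 y : extend_coef y != 0 -> exists x, v x != 0 /\ f x y != 0.
Proof.
apply: contra_neqP => h; apply: fsbig1 => x _.
apply/eqP; rewrite mulf_eq0; apply/negPn/negP; rewrite negb_or => /andP[h1 h2].
by apply: h; exists x.
Qed.

(* the sum defining [extend_coef] is finite *)
Lemma extend_supp n : finite_set [set x | v x != 0 /\ tri (bideg x) n]%classic.
Proof.
have [k hk] := coef_bnd v.
pose B := (`I_n.1.+1 `*` `I_k.+1)%classic.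
have fB : finite_set B by apply: finite_setX; exact: finite_II.
have : finite_set (\bigcup_(q in B) [set x | bideg x = q /\ v x != 0])%classic.
  by apply: bigcup_finite => // q _; exact: coef_fin.
apply: sub_finite_set => x [/= vx /andP[h1 h2]]; exists (bideg x) => //.
by split => /=; rewrite ltnS // hk.
Qed.

Lemma extend_fin n : finite_set [set y | bideg y = n /\ extend_coef y != 0]%classic.
Proof.
have : finite_set (\bigcup_(x in [set x | v x != 0 /\ tri (bideg x) n])
    [set y | bideg y = n /\ f x y != 0])%classic.
  by apply: bigcup_finite; [exact: extend_supp|move=> x _; exact: coef_fin].
apply: sub_finite_set => y /= [yn /extend_coefN0[x [vx fxy]]]; exists x => //=.
by split=> //; have := tvalP fxy; rewrite yn.
Qed.

Lemma extend_bnd : exists k : nat, forall y, extend_coef y != 0 -> ((bideg y).2 <= k)%N.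
Proof.
have [k hk] := coef_bnd v; exists k => y /extend_coefN0[x [vx /tvalP/andP[_ h]]].
exact: leq_trans h (hk _ vx).
Qed.

Definition extend : series R Y := Series extend_fin extend_bnd.

End Extend.
End Series.

Section Bidegree.
Variables (L : finType) (d : nat).

Definition forest_bideg (N E : finType) (D : dforest L d N E) : nat * nat :=
  (\sum_e \sum_l edec D e l,
   #|[pred x | (ncol D x == 0) && ~~ is_root D x]| + #|[pred e | ecol D e == 0]|)%N.

Lemma iso_root (N E N' E' : finType) (F : cforest L N E) (F' : cforest L N' E')
  f g : cforest_iso F F' f g -> forall x, is_root F' (f x) = is_root F x.
Proof.
move=> [bf [g' gK g'K] _ ht _ _ _] x; apply/forallP/forallP => h e.
  by move: (h (g e)); rewrite ht (inj_eq (bij_inj bf)).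
by rewrite -(g'K e) ht (inj_eq (bij_inj bf)).
Qed.

Lemma forest_bideg_iso (N E N' E' : finType) (D : dforest L d N E)
    (D' : dforest L d N' E') : dforest_iso D D' -> forest_bideg D = forest_bideg D'.
Proof.
move=> [f [g [h _ _ hed]]]; have [bf bg _ _ _ hn he] := h.
rewrite /forest_bideg; congr pair.
  rewrite [RHS](reindex g) /=; last exact: onW_bij.
  by apply: eq_bigr => e _; rewrite hed.
congr addn; rewrite -!sum1_card.
  rewrite [RHS](reindex f) /=; last exact: onW_bij.
  by apply: eq_bigl => x; rewrite !inE hn (iso_root h).
rewrite [RHS](reindex g) /=; last exact: onW_bij.
by apply: eq_bigl => x; rewrite !inE he.
Qed.

HB.instance Definition _ := isBigraded.Build (decforest L d)
  (fun tau => forest_bideg (repr tau)).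

Lemma bideg_class (N E : finType) (D : dforest L d N E) :
  bideg (iso_class D) = forest_bideg D.
Proof. by apply/esym/forest_bideg_iso; exact: iso_class_repr. Qed.

End Bidegree.

Section DisjointUnion.
Variables (L : finType) (d : nat) (N E N' E' : finType).
Variables (D : dforest L d N E) (D' : dforest L d N' E').

Definition dunion_src (e : E + E') : (N + N')%type :=
  match e with inl e => inl (src D e) | inr e => inr (src D' e) end.
Definition dunion_tgt (e : E + E') : (N + N')%type :=
  match e with inl e => inl (tgt D e) | inr e => inr (tgt D' e) end.

Lemma dunion_tgt_inj : injective dunion_tgt.
Proof. by move=> [e|e] [e'|e'] //= [] /tgt_inj ->. Qed.

Lemma dunion_connect_l x z : connect (edge_rel dunion_src dunion_tgt) (inl x) z ->
  exists2 y, z = inl y & connect (edge_rel (src D) (tgt D)) x y.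
Proof.
move=> /connectP[p + ->]; elim: p x => [|w p IH] x /=.
  by exists x.
move=> /andP[/existsP[[e|e] //= /andP[/eqP[<-] /eqP <-]] /IH[y -> h]].
exists y => //; apply: connect_trans h; apply: connect1.
by apply/existsP; exists e; rewrite !eqxx.
Qed.

Lemma dunion_connect_r x z : connect (edge_rel dunion_src dunion_tgt) (inr x) z ->
  exists2 y, z = inr y & connect (edge_rel (src D') (tgt D')) x y.
Proof.
move=> /connectP[p + ->]; elim: p x => [|w p IH] x /=.
  by exists x.
move=> /andP[/existsP[[e|e] //= /andP[/eqP[<-] /eqP <-]] /IH[y -> h]].
exists y => //; apply: connect_trans h; apply: connect1.
by apply/existsP; exists e; rewrite !eqxx.
Qed.

Lemma dunion_acyclic e :
  ~~ connect (edge_rel dunion_src dunion_tgt) (dunion_tgt e) (dunion_src e).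
Proof.
apply/negP; case: e => e /=.
  by move=> /dunion_connect_l[y [<-]]; apply/negP; exact: acyclic.
by move=> /dunion_connect_r[y [<-]]; apply/negP; exact: acyclic.
Qed.

Definition dunion_typ (e : E + E') : L :=
  match e with inl e => typ D e | inr e => typ D' e end.

Definition dunion_forest : forest L (N + N')%type (E + E')%type :=
  Forest dunion_typ dunion_tgt_inj dunion_acyclic.

Definition dunion_ncol (x : N + N') : nat :=
  match x with inl x => ncol D x | inr x => ncol D' x end.
Definition dunion_ecol (e : E + E') : nat :=
  match e with inl e => ecol D e | inr e => ecol D' e end.

Lemma dunion_col_ok (e : E + E') : dunion_ecol e != 0%N ->
  dunion_ncol (src dunion_forest e) = dunion_ecol e /\
  dunion_ncol (tgt dunion_forest e) = dunion_ecol e.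
Proof. by case: e => e /=; exact: col_ok. Qed.

Definition dunion_cforest : cforest L (N + N')%type (E + E')%type :=
  CForest dunion_col_ok.

Definition dunion_ndec (x : N + N') : Ndec d :=
  match x with inl x => ndec D x | inr x => ndec D' x end.
Definition dunion_odec (x : N + N') : Zdec L d :=
  match x with inl x => odec D x | inr x => odec D' x end.
Definition dunion_edec (e : E + E') : Ndec d :=
  match e with inl e => edec D e | inr e => edec D' e end.

Lemma dunion_odec_ok x : ncol dunion_cforest x = 0%N -> dunion_odec x = 0.
Proof. by case: x => x /=; exact: odec_ok. Qed.

Lemma dunion_edec_ok e : ecol dunion_cforest e != 0%N -> dunion_edec e = 0.
Proof. by case: e => e /=; exact: edec_ok. Qed.

Definition dunion : dforest L d (N + N')%type (E + E')%type :=
  DForest dunion_ndec dunion_odec_ok dunion_edec_ok.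

Lemma dunion_root_l x : is_root dunion (inl x) = is_root D x.
Proof.
apply/forallP/forallP => h e; first exact: (h (inl e)).
by case: e => e //=; exact: (h e).
Qed.

Lemma dunion_root_r x : is_root dunion (inr x) = is_root D' x.
Proof.
apply/forallP/forallP => h e; first exact: (h (inr e)).
by case: e => e //=; exact: (h e).
Qed.

Lemma forest_bideg_dunion : forest_bideg dunion =
  ((forest_bideg D).1 + (forest_bideg D').1,
   (forest_bideg D).2 + (forest_bideg D').2)%N.
Proof.
rewrite /forest_bideg /=; congr pair; first by rewrite big_sumType.
rewrite -!sum1_card !big_sumType /=.
under eq_bigl => x do rewrite inE dunion_root_l.
under [X in (_ + X + _)%N]eq_bigl => x do rewrite inE dunion_root_r.
exact: addnACA.
Qed.

End DisjointUnion.

Definition forest_mul (L : finType) (d : nat) (tau sigma : decforest L d) :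
    decforest L d :=
  iso_class (dunion (repr tau) (repr sigma)).

Section M1324.
Variables (R : realType) (L : finType) (d : nat).
Local Notation FF := (decforest L d).

Definition mul13_fun (t : (FF * FF) * (FF * FF)) : FF * (FF * FF) :=
  (forest_mul t.1.1 t.2.1, (t.1.2, t.2.2)).

Lemma mul13_tri (t : (FF * FF) * (FF * FF)) : tri (bideg t) (bideg (mul13_fun t)).
Proof.
case: t => [[t1 t2] [t3 t4]].
have e : bideg (forest_mul t1 t3) =
    ((bideg t1).1 + (bideg t3).1, (bideg t1).2 + (bideg t3).2)%N.
  by rewrite bideg_class forest_bideg_dunion.
suff -> : bideg (mul13_fun ((t1, t2), (t3, t4))) = bideg ((t1, t2), (t3, t4)).
  exact: tri_refl.
transitivity ((bideg (forest_mul t1 t3)).1 + ((bideg t2).1 + (bideg t4).1),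
  (bideg (forest_mul t1 t3)).2 + ((bideg t2).2 + (bideg t4).2))%N => //.
by rewrite e; congr pair; exact: addnACA.
Qed.

(* the map M^{(13)(2)(4)} *)
Definition mul13 : tmap R ((FF * FF) * (FF * FF))%type (FF * (FF * FF))%type :=
  pure R mul13_tri.

End M1324.

Definition src_sum (L N E : finType) (F : forest L N E) (V : nmodType)
    (f : E -> V) (x : N) : V :=
  \sum_(e | src F e == x) f e.

Section Delta.
Variables (R : realType) (L : finType) (d i : nat) (U : sub_family L).
Hypotheses (hi : (0 < i)%N) (hU : assumption1 i U).

Section Terms.
Variables (N E : finType) (D : dforest L d N E).

(* the triples [(A, n_A, eps)] over which the sum defining [Delta_i] ranges *)
Definition delta_range
    (t : subforest D * {ffun N -> Ndec d} * {ffun E -> Ndec d}) : bool :=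
  let: (A, nA, eps) := t in
  [&& A \in U D,
      [forall x, (nA x != 0) ==> (x \in snodes A)] &
      [forall e, (eps e != 0) ==> (e \notin sedges A) && (src D e \in snodes A)]].

Definition delta_index : choiceType := {t | delta_range t}.

Definition ix_sub (t : delta_index) : subforest D := (sval t).1.1.
Definition ix_n (t : delta_index) : {ffun N -> Ndec d} := (sval t).1.2.
Definition ix_eps (t : delta_index) : {ffun E -> Ndec d} := (sval t).2.

Section Term.
Variable t : delta_index.
Let A := ix_sub t.
Let nA := ix_n t.
Let eps := ix_eps t.

Lemma ix_in : A \in U D.
Proof. by rewrite /A /ix_sub; case: (t) => [[[? ?] ?] /= /and3P[]]. Qed.

Lemma ix_n_supp x : x \notin snodes A -> nA x = 0.
Proof.
rewrite /A /nA /ix_n /ix_sub; case: (t) => [[[? ?] ?] /= /and3P[_ /forallP h _]].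
by move: (h x); case: eqP => //= _ ->.
Qed.

Lemma ix_eps_in e : e \in sedges A -> eps e = 0.
Proof.
rewrite /A /eps /ix_eps /ix_sub; case: (t) => [[[? ?] ?] /= /and3P[_ _ /forallP h]].
by move: (h e); case: eqP => //= _ /andP[/negbTE ->].
Qed.

Lemma ix_eps_src e : src D e \notin snodes A -> eps e = 0.
Proof.
rewrite /A /eps /ix_eps /ix_sub; case: (t) => [[[? ?] ?] /= /and3P[_ _ /forallP h]].
by move: (h e); case: eqP => //= _ /andP[_ ->].
Qed.

Lemma delta_left_odec (x : sub_node A) : ncol (restr D A) x = 0%N -> odec D (sval x) = 0.
Proof. exact: odec_ok. Qed.

Lemma delta_left_edec (e : sub_edge A) : ecol (restr D A) e != 0%N -> edec D (sval e) = 0.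
Proof. exact: edec_ok. Qed.

Definition delta_left : dforest L d (sub_node A) (sub_edge A) :=
  @DForest L d (sub_node A) (sub_edge A) (restr D A)
    (fun x => nA (sval x) + src_sum D eps (sval x))
    (fun x => odec D (sval x)) (fun e => edec D (sval e))
    delta_left_odec delta_left_edec.

Definition delta_right_cforest : cforest L N E := recol (a1_adm hU ix_in).

(* The subtraction is truncated, but [delta_weight] vanishes unless [nA <= n]. *)
Definition delta_right_ndec (x : N) : Ndec d :=
  [ffun l => (ndec D x l - nA x l)%N].

Definition delta_right_odec (x : N) : Zdec L d :=
  odec D x + Zdec_of_Z L (Z_of_N (nA x)) +
  Zdec_of_Z L (src_sum D (fun e => Z_of_N (eps e) -
    (if e \in sedges A then Z_of_N (edec D e) else 0)) x).

Definition delta_right_edec (e : E) : Ndec d :=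
  (if e \in sedges A then 0 else edec D e) + eps e.

Lemma Z_of_N0 : Z_of_N (0 : Ndec d) = 0.
Proof. by apply/ffunP => l; rewrite !ffunE. Qed.

Lemma delta_right_odec_ok x : ncol delta_right_cforest x = 0%N -> delta_right_odec x = 0.
Proof.
rewrite /= /recol_node; case: (boolP (x \in snodes A)) => [_ i0|xA x0].
  by move: hi; rewrite i0.
rewrite /delta_right_odec odec_ok // ix_n_supp // Z_of_N0 /src_sum big1 ?addr0 //.
move=> e /eqP se; rewrite ix_eps_src ?se // Z_of_N0.
case: ifP => [/src_sub|_]; last by rewrite subr0.
by rewrite se (negbTE xA).
Qed.

Lemma delta_right_edec_ok e : ecol delta_right_cforest e != 0%N -> delta_right_edec e = 0.
Proof.
rewrite /= /recol_edge /delta_right_edec; case: (boolP (e \in sedges A)) => eA.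
  by rewrite ix_eps_in // addr0.
move=> e0; rewrite edec_ok // ix_eps_src ?addr0 //.
apply: contra eA => h; apply: (admissible_edge (a1_adm hU ix_in) e0); by left.
Qed.

Definition delta_right : dforest L d N E :=
  DForest delta_right_ndec delta_right_odec_ok delta_right_edec_ok.

Definition delta_weight : R :=
  (\prod_e \prod_l (eps e l)`!)%N%:R^-1 *
  (\prod_x \prod_l 'C(ndec D x l, nA x l))%N%:R.

Definition delta_term : decforest L d * decforest L d :=
  (iso_class delta_left, iso_class delta_right).

End Term.

Definition delta_coef (y : decforest L d * decforest L d) : R :=
  \sum_(t \in [set: delta_index]%classic) delta_weight t * (delta_term t == y)%:R.

Lemma delta_weight_le t : delta_weight t != 0 ->
  forall x l, (ix_n t x l <= ndec D x l)%N.
Proof.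
rewrite mulf_eq0 negb_or => /andP[_]; rewrite pnatr_eq0 -lt0n => h x l.
have hx := gt0_prodn h x isT.
by rewrite -bin_gt0; exact: (gt0_prodn hx l isT).
Qed.

Lemma bideg_delta_term t : bideg (delta_term t) =
  ((forest_bideg (delta_left t)).1 + (forest_bideg (delta_right t)).1,
   (forest_bideg (delta_left t)).2 + (forest_bideg (delta_right t)).2)%N.
Proof. by rewrite -!bideg_class. Qed.

Lemma delta_bideg1 t : (bideg (delta_term t)).1 =
  ((forest_bideg D).1 + \sum_e \sum_l ix_eps t e l)%N.
Proof.
rewrite bideg_delta_term /forest_bideg /=.
rewrite -(big_sub (mem (sedges (ix_sub t))) (fun e => \sum_l edec D e l)%N) /=.
rewrite [X in (_ + X)%N](_ : _ = \sum_(e | e \notin sedges (ix_sub t)) \sum_l edec D e l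
   + \sum_e \sum_l ix_eps t e l)%N.
  rewrite addnA; congr addn.
  by rewrite [RHS](bigID (mem (sedges (ix_sub t)))).
rewrite [X in (X + _)%N]big_mkcond /= -big_split /=; apply: eq_bigr => e _.
rewrite /delta_right_edec; case: ifP => _ /=.
  by rewrite add0r.
rewrite -big_split /=.
by apply: eq_bigr => l _; rewrite !ffunE.
Qed.

Lemma card_split (T : finType) (A : {set T}) (P : pred {x : T | x \in A}) (Q S : pred T) :
  (forall x, P x -> S (sval x)) -> (forall x, Q x -> S x && (x \notin A)) ->
  (#|P| + #|Q| <= #|S|)%N.
Proof.
move=> hP hQ; rewrite -(cardID (mem A) S); apply: leq_add.
  rewrite -(card_imset P val_inj); apply: subset_leq_card.
  apply/fintype.subsetP => _ /imsetP[x xP ->]; rewrite !inE.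
  apply/andP; split; first by [exact: hP | exact: valP].
  by [exact: hP | exact: valP].
apply: subset_leq_card; apply/fintype.subsetP => x /hQ /andP[h1 h2].
by rewrite !inE h2.
Qed.

Lemma delta_bideg2 t : ((bideg (delta_term t)).2 <= (forest_bideg D).2)%N.
Proof.
rewrite bideg_delta_term /forest_bideg /= addnACA; apply: leq_add.
  apply: card_split => x /andP[/= hc hr].
    rewrite /= hc /=; apply: contra hr => /forallP h; apply/forallP => e.
    by apply: contra (h (sval e)) => /eqP <-.
  rewrite /= hr andbT; move: hc; rewrite /recol_node; case: ifP => [_ /eqP i0|_ ->] //.
  by move: hi; rewrite i0.
apply: card_split => e /=; first by [].
rewrite /recol_edge; case: ifP => [_ /eqP i0|_ ->] //.
by move: hi; rewrite i0.
Qed.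

Lemma delta_tri t : tri (forest_bideg D) (bideg (delta_term t)).
Proof. by rewrite /tri delta_bideg1 leq_addr delta_bideg2. Qed.

Lemma delta_index_fin m : finite_set
  [set t | delta_weight t != 0 /\ ((bideg (delta_term t)).1 <= m)%N]%classic.
Proof.
pose M := (m + \sum_x \sum_l ndec D x l)%N.
pose bnd : finType := (subforest D * {ffun N -> {ffun 'I_d -> 'I_M.+1}} *
  {ffun E -> {ffun 'I_d -> 'I_M.+1}})%type.
pose g (b : bnd) : subforest D * {ffun N -> Ndec d} * {ffun E -> Ndec d} :=
  (b.1.1, [ffun x => [ffun l => b.1.2 x l : nat]],
   [ffun e => [ffun l => b.2 e l : nat]]).
have fg : finite_set (g @` [set: bnd])%classic by apply: finite_image; exact: finite_finset.
have : finite_set ((fun t : delta_index => val t) @^-1` (g @` [set: bnd]))%classic.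
  by apply: finite_preimage => //; move=> t t' _ _; exact: val_inj.
apply: sub_finite_set => t [/delta_weight_le hw].
rewrite delta_bideg1 => hm.
have hn x l : (ix_n t x l < M.+1)%N.
  rewrite ltnS (leq_trans (hw x l)) // /M (bigD1 x) //= (bigD1 l) //=.
  by rewrite -!addnA addnCA leq_addr.
have he e l : (ix_eps t e l < M.+1)%N.
  rewrite ltnS; apply: leq_trans (leq_addr _ _); apply: leq_trans hm.
  by rewrite (bigD1 e) //= (bigD1 l) //= -addnA addnCA leq_addr.
exists (ix_sub t, [ffun x => [ffun l => Ordinal (hn x l)]],
  [ffun e => [ffun l => Ordinal (he e l)]]) => //.
rewrite /g /= /ix_sub /ix_n /ix_eps in hn he *.
case: (sval t) hn he => [[A nA] eps] /= hn he; congr (_, _, _).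
  by apply/ffunP => x; rewrite ffunE; apply/ffunP => l; rewrite !ffunE.
by apply/ffunP => x; rewrite ffunE; apply/ffunP => l; rewrite !ffunE.
Qed.

Lemma delta_coefN0 y : delta_coef y != 0 ->
  exists t, delta_weight t != 0 /\ delta_term t = y.
Proof.
apply: contra_neqP => h; apply: fsbig1 => t _.
have [ty|_] := eqVneq (delta_term t) y; last by rewrite mulr0.
by rewrite mulr1; apply: contra_notP h => /eqP w0; exists t.
Qed.

Lemma delta_fin n : finite_set [set y | bideg y = n /\ delta_coef y != 0]%classic.
Proof.
have := finite_image delta_term (delta_index_fin n.1).
apply: sub_finite_set => y [yn /delta_coefN0[t [w0 ty]]].
by exists t => //; split=> //; rewrite ty yn.
Qed.

Lemma delta_bnd : exists k : nat, forall y, delta_coef y != 0 -> ((bideg y).2 <= k)%N.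
Proof.
exists (forest_bideg D).2 => y /delta_coefN0[t [_ <-]]; exact: delta_bideg2.
Qed.

Definition delta_series : series R (decforest L d * decforest L d)%type :=
  Series delta_fin delta_bnd.

End Terms.

Lemma Delta_tri (tau : decforest L d) y :
  delta_series (repr tau) y != 0 -> tri (bideg tau) (bideg y).
Proof. by move=> /delta_coefN0[t [_ <-]]; exact: delta_tri. Qed.

(* [Delta_i tau] is computed on a representative of [tau]; it does not
   depend on this choice, by the compatibility of [U] with isomorphisms. *)
Definition Delta : tmap R (decforest L d) (decforest L d * decforest L d)%type :=
  TMap Delta_tri.

End Delta.

(* Main.v *)
Require Import Defs.
From mathcomp Require Import all_boot all_order all_algebra.
From mathcomp Require Import boolp classical_sets functions.
From mathcomp Require Import cardinality fsbigop reals ereal esum ring.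

(** All coefficients of [Delta_i] and [Delta_j] are nonnegative, so the
coefficients of both sides of the identity can be rearranged freely as sums in
[0, +oo], indexed on the left by [(B, n_B, eps_B)], [(A2, n_2, eps_2)],
[(A1, n_1, eps_1)] and on the right by [(A, n_A, eps_A)], [(B, n_B', eps_B')].
Let [eps_3] be the restriction of [eps_A] to the edges that leave [B]. By
Assumption 6, [A = A1 + A2] with [A2] the part of [A] inside [B], and the same
triple of forests is obtained when
  [n_B = n_A 1_B + n_B'], [eps_B = eps_3 + eps_B'],
  [n_2 = n_A + pi eps_3] and [eps_2 = eps_A] on [B],
  [n_1 = n_A] and [eps_1 = eps_A] off [B].
Given the left indices, the right ones are thus determined by [eps_3 <= eps_B],
and the weights agree after summation over [eps_3], by the Chu-Vandermonde
identity [sum_c C(b, c) C(n, m - c) = C(n + b, m)] at every node, with [n = n_B],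
[b = pi eps_B] and [m = n_2]. *)

Set Implicit Arguments.
Unset Strict Implicit.
Unset Printing Implicit Defensive.

Import Order.TTheory GRing.Theory Num.Theory.

Local Open Scope ring_scope.

(** * Sums of nonnegative families *)

Section EsumLemmas.
Variable R : realType.
Local Open Scope classical_set_scope.
Local Open Scope ereal_scope.

Lemma esumZ (T : choiceType) (c : R) (a : T -> R) :
  (0 <= c)%R -> (forall t, 0 <= a t)%R ->
  \esum_(t in [set: T]) (c * a t)%:E = c%:E * \esum_(t in [set: T]) (a t)%:E.
Proof.
move=> c0 a0; rewrite /esum -ereal_supZl //; last first.
  by apply/set0P; exists (\sum_(t \in set0) (a t)%:E), set0 => //; exact: fsets_set0.
congr ereal_sup; rewrite image_comp; apply: eq_imagel => F _ /=.
rewrite ge0_mule_fsumr; last by move=> t; rewrite lee_fin.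
by apply: eq_fsbigr => t _; rewrite EFinM.
Qed.

(** The sets [J x] partition [K], so each [k] is the second component of exactly one pair [(x, k)]
    with [J x k]; this turns the double sum into a sum over [K]. *)
Lemma esum_partition (K X : choiceType) (J : X -> set K) (a : K -> R) :
  (forall x y k, J x k -> J y k -> x = y) -> (forall k, exists x, J x k) ->
  (forall k, 0 <= a k)%R ->
  \esum_(k in [set: K]) (a k)%:E =
  \esum_(x in [set: X]) \esum_(k in J x) (a k)%:E.
Proof.
move=> Jinj Jsurj a0; rewrite esum_esum; last by move=> *; rewrite lee_fin.
have h : set_bij ([set: X] `*`` J) [set: K] snd; last first.
  exact: (reindex_esum _ _ _ (fun k => (a k)%:E) h).
split=> //.
- move=> [x k] [y l] /set_mem[_ /= xk] /set_mem[_ /= yl] /= kl.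
  by rewrite -kl in yl *; rewrite (Jinj _ _ _ xk yl).
- by move=> k _; have [x xk] := Jsurj k; exists (x, k).
Qed.

Lemma esum_sigT (I : choiceType) (J : I -> choiceType) (a : {i : I & J i} -> R) :
  (forall k, 0 <= a k)%R ->
  \esum_(k in [set: {i : I & J i}]) (a k)%:E =
  \esum_(i in [set: I]) \esum_(j in [set: J i]) (a (existT _ i j))%:E.
Proof.
move=> a0; rewrite (@esum_partition _ _ (fun i => [set k | tag k = i])) //; first last.
- by move=> k; exists (tag k).
- by move=> i i' k /= -> .
apply: eq_esum => i _.
rewrite (@reindex_esum _ (J i) _ [set: J i] _ (existT J i)) //; split.
- by move=> j _.
- by move=> j j' _ _ /eqP; rewrite -tag_eqE /tag_eq eqxx /= => /eqP; rewrite tagged_asE.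
- by case=> i' j /= <-; exists j.
Qed.

Lemma exchange_esum (I J : choiceType) (a : I -> J -> R) :
  (forall i j, 0 <= a i j)%R ->
  \esum_(i in [set: I]) \esum_(j in [set: J]) (a i j)%:E =
  \esum_(j in [set: J]) \esum_(i in [set: I]) (a i j)%:E.
Proof.
move=> a0; rewrite !esum_esum; try by move=> *; rewrite lee_fin.
rewrite (@reindex_esum _ _ _ ([set: J] `*`` (fun=> [set: I])) _ (fun x => (x.2, x.1))) //.
split=> //; first by move=> [? ?] [? ?] _ _ [-> ->].
by move=> [i j] _; exists (j, i).
Qed.

Lemma esum_delta (X : choiceType) (x : X) (c : R) : (0 <= c)%R ->
  \esum_(z in [set: X]) (c * (x == z)%:R)%:E = c%:E.
Proof.
move=> c0; rewrite (esumID [set x]) ?setTI; last first.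
  by move=> z _; rewrite lee_fin mulr_ge0.
rewrite esum_set1 ?eqxx ?mulr1 ?lee_fin // esum1 ?adde0 // => z /= /eqP.
by rewrite eq_sym => /negbTE ->; rewrite mulr0.
Qed.

End EsumLemmas.

(** * Series presented by weighted families *)

Section Presentations.
Variable R : realType.

(** The sum in [R] is 0 by convention when its support is infinite; the finite set [S] excludes this
    case. *)
Lemma EFin_fsbig (T : choiceType) (S : set T) (a : T -> R) : finite_set S ->
  (forall t, a t != 0 -> S t) -> (forall t, 0 <= a t) ->
  (\sum_(t \in [set: T]%classic) a t)%:E = \esum_(t in [set: T]%classic) (a t)%:E.
Proof.
move=> finS aS a0.
rewrite (esumID S) ?setTI; last by move=> t _; rewrite lee_fin.
rewrite [X in (_ + X)%E]esum1 ?adde0; last first.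
  by move=> t /= nS; congr EFin; apply: contra_notP nS => /eqP /aS.
rewrite esum_fset //; last by move=> t _; rewrite lee_fin.
rewrite -(@fsbig_widen _ _ _ _ S) //; last first.
  by move=> t [_ nS]; apply: contra_notP nS => /eqP /aS.
by rewrite !fsbig_finite // -sumEFin.
Qed.

(* [h] may take a value infinitely often. *)
Definition presents (X : bigradedType) (v : series R X) (I : choiceType)
    (w : I -> R) (h : I -> X) : Prop :=
  (forall i, 0 <= w i) /\
  forall y, (v y)%:E = \esum_(i in [set: I]%classic) (w i * (h i == y)%:R)%:E.

Lemma presents_ge0 (X : bigradedType) (v : series R X) (I : choiceType)
    (w : I -> R) (h : I -> X) : presents v w h -> forall y, 0 <= v y.
Proof.
move=> [w0 vE] y; rewrite -lee_fin vE; apply: esum_ge0 => i _.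
by rewrite lee_fin mulr_ge0.
Qed.

Lemma presents_neq0 (X : bigradedType) (v : series R X) (I : choiceType)
    (w : I -> R) (h : I -> X) : presents v w h ->
  forall y, v y != 0 -> exists i, h i = y.
Proof.
move=> [w0 vE] y; apply: contra_neqP => hy; apply: EFin_inj; rewrite vE.
apply: esum1 => i _; case: eqVneq => [hiy|_]; last by rewrite mulr0.
by case: hy; exists i.
Qed.

(** The relation [J] is the graph of a map from [K'] to [K]. The second family is summed along the
    fibres of this map, on which the basis element is constant. *)
Lemma presents_fibres (X : bigradedType) (v v' : series R X)
    (K K' : choiceType) (w : K -> R) (h : K -> X) (w' : K' -> R) (h' : K' -> X)
    (J : K -> K' -> Prop) :
  presents v w h -> presents v' w' h' ->
  (forall k1 k2 k', J k1 k' -> J k2 k' -> k1 = k2) -> (forall k', exists k, J k k') ->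
  (forall k k', J k k' -> h k = h' k') ->
  (forall k, (w k)%:E = \esum_(k' in [set k' | J k k']%classic) (w' k')%:E) ->
  v = v'.
Proof.
move=> [w0 vE] [w'0 v'E] Jinj Jsurj hh' wE; apply: seriesP => y.
apply: EFin_inj; rewrite vE v'E (esum_partition Jinj Jsurj); last first.
  by move=> k'; rewrite mulr_ge0.
apply: eq_esum => k _.
transitivity (\esum_(k' in [set k' | J k k']%classic) (w' k' * (h k == y)%:R)%:E).
  case: eqP => _; last by rewrite mulr0 esum1 // => k' _; rewrite mulr0.
  by rewrite mulr1 wE; apply: eq_esum => k' _; rewrite mulr1.
by apply: eq_esum => k' /= kk'; rewrite (hh' _ _ kk').
Qed.

Lemma presents_pure (X Y : bigradedType) (h : X -> Y)
    (h_tri : forall x, tri (bideg x) (bideg (h x))) (x : X) :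
  presents (pure R h_tri x) (fun=> 1) (fun _ : unit => h x).
Proof.
split=> // y; rewrite [[set: unit]%classic](_ : _ = [set tt]%classic).
  by rewrite esum_set1 ?mul1r // lee_fin.
by apply/seteqP; split => // -[].
Qed.

Lemma presents_tensor (X X' Y Y' : bigradedType) (f : tmap R X Y) (g : tmap R X' Y')
    (x : X * X') (I J : choiceType) (w : I -> R) (h : I -> Y) (w' : J -> R) (h' : J -> Y') :
  presents (f x.1) w h -> presents (g x.2) w' h' ->
  presents (tensor f g x) (fun k : I * J => w k.1 * w' k.2) (fun k => (h k.1, h' k.2)).
Proof.
move=> [w0 fE] fg; have g0 := presents_ge0 fg; move: fg => [w'0 gE].
split=> [k|[y y']]; first exact: mulr_ge0.
rewrite /= mulrC EFinM fE -esumZ //; last by move=> i; rewrite mulr_ge0.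
under eq_esum => i _.
  rewrite mulrC EFinM gE -esumZ ?mulr_ge0 //; last by move=> j; rewrite mulr_ge0.
  over.
rewrite esum_esum; last by move=> i j _ _; rewrite lee_fin !mulr_ge0.
rewrite [X in esum X](_ : _ = [set: I * J]%classic); last by apply/seteqP; split.
apply: eq_esum => -[i j] _ /=; congr EFin.
by rewrite -pair_eqE /pair_eq /= -mulnb natrM mulrACA.
Qed.

Lemma presents_tid_tensor (X X' Y' : bigradedType) (g : tmap R X' Y') (x : X * X')
    (J : choiceType) (w : J -> R) (h : J -> Y') :
  presents (g x.2) w h -> presents (tensor (tid R X) g x) w (fun j => (x.1, h j)).
Proof.
move=> [w0 gE]; split=> // -[y y'] /=.
rewrite EFinM gE -esumZ //; last by move=> j; rewrite mulr_ge0.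
apply: eq_esum => j _; congr EFin.
by rewrite -pair_eqE /pair_eq /= -mulnb natrM mulrCA.
Qed.

(** The presentation of [v] is substituted into the coefficients of the extension, the sums over [x]
    and [i] are exchanged, and only [x = h i] survives. Iterated maps thereby become sums over
    explicit indices. *)
Lemma presents_extend (X Y : bigradedType) (f : tmap R X Y) (v : series R X)
    (I : choiceType) (w : I -> R) (h : I -> X)
    (J : I -> choiceType) (w' : forall i, J i -> R) (h' : forall i, J i -> Y) :
  presents v w h -> (forall i, presents (f (h i)) (@w' i) (@h' i)) ->
  presents (extend f v) (fun k : {i : I & J i} => w (tag k) * w' _ (tagged k))
    (fun k => h' _ (tagged k)).
Proof.
move=> vP fP; have v0 := presents_ge0 vP; have vN0 := presents_neq0 vP.
have f0 i y : 0 <= f (h i) y by exact: presents_ge0 (fP i) y.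
case: vP => w0 vE.
split=> [[i j]|y]; first by rewrite mulr_ge0 //; case: (fP i).
(* Nothing is known about the sign of [f x] off the image of [h], but there [v x] vanishes. *)
have vf0 x : 0 <= v x * f x y.
  have [->|/vN0[i <-]] := eqVneq (v x) 0; first by rewrite mul0r.
  exact: mulr_ge0.
(* Triangularity of [f] confines the contributing [x] to a finite set. *)
rewrite /= /extend_coef (EFin_fsbig (extend_supp v (bideg y))) //; last first.
  by move=> x; rewrite mulf_eq0 negb_or => /andP[vx /tvalP].
transitivity (\esum_(x in [set: X]%classic) \esum_(i in [set: I]%classic)
    ((w i * f (h i) y) * (h i == x)%:R)%:E).
  apply: eq_esum => x _; have [vx0|/vN0[i0 hi0]] := eqVneq (v x) 0.
    rewrite vx0 mul0r; apply/esym; apply: esum1 => i _.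
    case: eqP => [hix|_]; last by rewrite mulr0.
    (* A single nonnegative term is at most the whole sum, here [v x = 0], so [w i] vanishes as soon
       as [h i = x]. *)
    have : ((w i)%:E <= (v x)%:E)%E.
      rewrite vE (esumID [set i]%classic); last first.
        by move=> j _; rewrite lee_fin mulr_ge0.
      rewrite setTI esum_set1 ?lee_fin ?mulr_ge0 // hix eqxx mulr1 leeDl //.
      by apply: esum_ge0 => j _; rewrite lee_fin mulr_ge0.
    rewrite lee_fin vx0 => wi0; have -> : w i = 0 by apply/eqP; rewrite eq_le wi0 w0.
    by rewrite !mul0r.
  rewrite mulrC EFinM vE -hi0 -esumZ //; last by move=> i; rewrite mulr_ge0.
  apply: eq_esum => i _; case: eqP => [->|_]; last by rewrite !mulr0.
  by rewrite !mulr1 mulrC.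
rewrite exchange_esum; last by move=> x i; rewrite !mulr_ge0.
rewrite esum_sigT; last first.
  by move=> [i j]; rewrite !mulr_ge0 //=; case: (fP i).
apply: eq_esum => i _ /=.
rewrite esum_delta ?mulr_ge0 //.
have [w'0 fE] := fP i.
rewrite EFinM fE -esumZ //; last by move=> j; rewrite mulr_ge0.
by apply: eq_esum => j _; rewrite mulrA.
Qed.

Lemma delta_weight_ge0 (L : finType) (d : nat) (U : sub_family L)
    (N E : finType) (D : dforest L d N E) (t : delta_index U D) :
  0 <= delta_weight R t.
Proof. by rewrite mulr_ge0 ?invr_ge0. Qed.

Lemma presents_delta (L : finType) (d i : nat) (U : sub_family L) (hi : (0 < i)%N)
    (hU : assumption1 i U) (N E : finType) (D : dforest L d N E) :
  presents (delta_series R hi hU D) (@delta_weight R L d U N E D)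
    (@delta_term L d i U hi hU N E D).
Proof.
split=> [t|y]; first exact: delta_weight_ge0.
rewrite /= /delta_coef.
apply: (EFin_fsbig (delta_index_fin R hi hU D (bideg y).1)) => t.
  by rewrite mulf_eq0 negb_or pnatr_eq0 eqb0 negbK => /andP[w0 /eqP <-].
by rewrite mulr_ge0 ?delta_weight_ge0.
Qed.

End Presentations.

(** * Invariance under isomorphism *)

Lemma subforest_ex (L N E : finType) (F : forest L N E) (P : {pred N}) (Q : {pred E}) :
  (forall e, e \in Q -> src F e \in P) -> (forall e, e \in Q -> tgt F e \in P) ->
  exists A : subforest F, snodes A =i P /\ sedges A =i Q.
Proof.
move=> hs ht.
have h : [forall e in ([set x in P], [set e in Q]).2,
    (src F e \in ([set x in P], [set e in Q]).1) &&
    (tgt F e \in ([set x in P], [set e in Q]).1)].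
  by apply/forall_inP => e /=; rewrite !inE => eQ; rewrite hs ?ht.
exists (exist _ ([set x in P], [set e in Q]) h); split => x.
  by rewrite /snodes /= inE.
by rewrite /sedges /= inE.
Qed.

Lemma subforest_eq (L N E : finType) (F : forest L N E) (A B : subforest F) :
  snodes A =i snodes B -> sedges A =i sedges B -> A = B.
Proof.
move=> /setP h /setP h'; apply: val_inj => /=; move: h h'.
by rewrite /snodes /sedges; case: (sval A) => ? ?; case: (sval B) => ? ? /= -> ->.
Qed.

Section Index.
Variables (L : finType) (d : nat) (U : sub_family L) (N E : finType) (D : dforest L d N E).

Lemma delta_index_ex (A : subforest D) (nA : {ffun N -> Ndec d}) (eps : {ffun E -> Ndec d}) :
  A \in U D -> (forall x, x \notin snodes A -> nA x = 0) ->
  (forall e, e \in sedges A -> eps e = 0) ->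
  (forall e, src D e \notin snodes A -> eps e = 0) ->
  exists t : delta_index U D, [/\ ix_sub t = A, ix_n t = nA & ix_eps t = eps].
Proof.
move=> hA hn he hs; have h : delta_range U (A, nA, eps).
  rewrite /delta_range hA /=; apply/andP; split.
    by apply/forallP => x; apply/implyP; apply: contraR => /hn ->.
  apply/forallP => e; apply/implyP => e0; apply/andP; split.
    by apply: contra e0 => /he ->.
  by apply: contraR e0 => /hs ->.
by exists (exist _ (A, nA, eps) h).
Qed.

Lemma delta_index_eq (t t' : delta_index U D) : ix_sub t = ix_sub t' ->
  ix_n t =1 ix_n t' -> ix_eps t =1 ix_eps t' -> t = t'.
Proof.
move=> hA /ffunP hn /ffunP he; apply: val_inj => /=; move: hA hn he.
rewrite /ix_sub /ix_n /ix_eps.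
by case: (sval t) => [[? ?] ?]; case: (sval t') => [[? ?] ?] /= -> -> ->.
Qed.

End Index.

Section Pullback.
Variables (L : finType) (d i : nat) (U : sub_family L).
Hypotheses (hi : (0 < i)%N) (hU : assumption1 i U).

Lemma cforest_iso_inv (N E N' E' : finType) (F : cforest L N E) (F' : cforest L N' E')
    f g f' g' : cforest_iso F F' f g -> cancel f f' -> cancel f' f ->
  cancel g g' -> cancel g' g -> cforest_iso F' F f' g'.
Proof.
move=> [_ _ hs ht hty hn he] fK f'K gK g'K.
split=> [||e|e|e|x|e]; first by exists f.
- by exists g.
- by rewrite -{2}(g'K e) hs fK.
- by rewrite -{2}(g'K e) ht fK.
- by rewrite -{2}(g'K e) hty.
- by rewrite -{2}(f'K x) hn.
- by rewrite -{2}(g'K e) he.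
Qed.

Lemma bijective_sub (T T' : finType) (f : T -> T') (A : {set T}) (A' : {set T'}) :
  bijective f -> (forall x, (f x \in A') = (x \in A)) ->
  exists2 h : {x | x \in A} -> {x | x \in A'}, bijective h &
    forall x, sval (h x) = f (sval x).
Proof.
move=> [f' fK f'K] fA.
have hA (x : {x | x \in A}) : f (sval x) \in A' by rewrite fA (svalP x).
have hA' (x : {x | x \in A'}) : f' (sval x) \in A by rewrite -fA f'K (svalP x).
exists (fun x => exist _ (f (sval x)) (hA x)) => //.
by exists (fun x => exist _ (f' (sval x)) (hA' x)) => x; apply: val_inj; rewrite /= ?fK ?f'K.
Qed.

Section Pair.
Variables (N E N' E' : finType) (D : dforest L d N E) (D' : dforest L d N' E').
Variables (f : N -> N') (g : E -> E').
Hypotheses (fg : cforest_iso D D' f g)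
  (ndecE : forall x, ndec D' (f x) = ndec D x)
  (odecE : forall x, odec D' (f x) = odec D x)
  (edecE : forall e, edec D' (g e) = edec D e).

(** Transport of indices along the isomorphism, kept as a relation so that membership and values are
    compared pointwise across different types. *)
Definition pullback (t : delta_index U D) (t' : delta_index U D') : Prop :=
  [/\ forall x, (f x \in snodes (ix_sub t')) = (x \in snodes (ix_sub t)),
      forall e, (g e \in sedges (ix_sub t')) = (e \in sedges (ix_sub t)),
      forall x, ix_n t' (f x) = ix_n t x &
      forall e, ix_eps t' (g e) = ix_eps t e].

Lemma pullback_inj t1 t2 t' : pullback t1 t' -> pullback t2 t' -> t1 = t2.
Proof.
move=> [h1 h2 h3 h4] [k1 k2 k3 k4]; apply: delta_index_eq.
- by apply: subforest_eq => x; rewrite -?h1 -?h2.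
- by move=> x; rewrite -h3.
- by move=> x; rewrite -h4.
Qed.

Lemma pullback_fun t t1 t2 : pullback t t1 -> pullback t t2 -> t1 = t2.
Proof.
have [[f' fK f'K] [g' gK g'K] _ _ _ _ _] := fg.
move=> [h1 h2 h3 h4] [k1 k2 k3 k4]; apply: delta_index_eq.
- apply: subforest_eq => x; first by rewrite -(f'K x) h1 k1.
  by rewrite -(g'K x) h2 k2.
- by move=> x; rewrite -(f'K x) h3 k3.
- by move=> x; rewrite -(g'K x) h4 k4.
Qed.

(** The preimage of the subforest of [t'] is a subforest because the isomorphism respects endpoints,
    and it lies in [U] because [U] is compatible with isomorphisms. *)
Lemma pullback_ex t' : exists t, pullback t t'.
Proof.
have [bf bg hs ht _ _ _] := fg.
have [f' fK f'K] := bf; have [g' gK g'K] := bg.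
have [|| A [An Ae]] := @subforest_ex _ _ _ D [pred x | f x \in snodes (ix_sub t')]
  [pred e | g e \in sedges (ix_sub t')].
- by move=> e; rewrite !inE -hs => /src_sub.
- by move=> e; rewrite !inE -ht => /tgt_sub.
have hA : A \in U D.
  rewrite -(a1_iso hU fg (A' := ix_sub t')); first exact: ix_in.
    apply/setP => x; rewrite -(f'K x) mem_imset ?An //; exact: bij_inj.
  apply/setP => x; rewrite -(g'K x) mem_imset ?Ae //; exact: bij_inj.
have [||| t [tA tn te]] := @delta_index_ex _ _ U _ _ D A
  [ffun x => ix_n t' (f x)] [ffun e => ix_eps t' (g e)] hA.
- by move=> x; rewrite ffunE An inE; exact: ix_n_supp.
- by move=> e; rewrite ffunE Ae inE; exact: ix_eps_in.
- by move=> e; rewrite ffunE An inE -hs; exact: ix_eps_src.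
exists t; split=> x.
- by rewrite tA An.
- by rewrite tA Ae.
- by rewrite tn ffunE.
- by rewrite te ffunE.
Qed.

Lemma src_sum_iso (V : nmodType) (h : E -> V) (h' : E' -> V) x :
  (forall e, h' (g e) = h e) -> src_sum D' h' (f x) = src_sum D h x.
Proof.
have [bf bg hs ht _ _ _] := fg.
move=> hh'; rewrite /src_sum (reindex g) /=; last exact: onW_bij.
by apply: eq_big => e; rewrite ?hs ?(inj_eq (bij_inj bf)) // => _.
Qed.

Lemma pullback_weight (R : realType) t t' : pullback t t' ->
  delta_weight R t = delta_weight R t'.
Proof.
have [bf bg _ _ _ _ _] := fg; move=> [_ _ hn he]; rewrite /delta_weight; congr (_^-1 * _).
  rewrite [in RHS](reindex g) /=; last exact: onW_bij.
  by congr (_%:R); apply: eq_bigr => e _; rewrite he.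
rewrite [in RHS](reindex f) /=; last exact: onW_bij.
by congr (_%:R); apply: eq_bigr => x _; rewrite hn ndecE.
Qed.

Lemma pullback_term t t' : pullback t t' -> delta_term hi hU t = delta_term hi hU t'.
Proof.
have [bf bg hs ht hty hc hec] := fg; move=> [hA hB hn he]; congr (_, _); apply/iso_classP.
  have [f1 bf1 f1E] := bijective_sub bf hA; have [g1 bg1 g1E] := bijective_sub bg hB.
  exists f1, g1; split.
  - split=> // e; rewrite /= ?f1E ?g1E //; apply: val_inj; rewrite /= f1E /=.
      by rewrite g1E hs.
    by rewrite g1E ht.
  - by move=> x /=; rewrite f1E hn (src_sum_iso _ he).
  - by move=> x /=; rewrite f1E.
  - by move=> x /=; rewrite g1E.
exists f, g; split.
- split=> // x /=; rewrite /recol_node /recol_edge ?hA ?hB ?hc ?hec //.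
- by move=> x; apply/ffunP => l; rewrite !ffunE ndecE hn.
- move=> x; rewrite /= /delta_right_odec odecE hn; congr (_ + Zdec_of_Z _ _).
  by apply: src_sum_iso => e; rewrite hB he edecE.
- by move=> e; rewrite /= /delta_right_edec hB he edecE.
Qed.

End Pair.

(** The relation [pullback] is a bijection between the indices that preserves weights and terms, so
    its fibres are single points. *)
Lemma delta_series_iso (R : realType) (N E N' E' : finType) (D : dforest L d N E)
  (D' : dforest L d N' E') : dforest_iso D D' ->
  delta_series R hi hU D = delta_series R hi hU D'.
Proof.
move=> [f [g [fg hn ho he]]].
have [[f' fK f'K] [g' gK g'K] _ _ _ _ _] := fg.
apply: (presents_fibres (J := fun t t' => pullback f g t t')
  (presents_delta R hi hU D) (presents_delta R hi hU D')).
- exact: pullback_inj.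
- exact: pullback_ex.
- exact: pullback_term.
(* The partner of [t] comes from the inverse isomorphism. *)
move=> t; have [t' [h1 h2 h3 h4]] := pullback_ex (cforest_iso_inv fg fK f'K gK g'K) t.
have tt' : pullback f g t t'.
  by split=> x; rewrite -?h1 -?h2 -?h3 -?h4 ?fK ?gK.
rewrite [[set _ | _]%classic](_ : _ = [set t']%classic).
  by rewrite esum_set1 ?lee_fin ?delta_weight_ge0 // (pullback_weight fg hn _ tt').
by apply/seteqP; split=> [t1 /= tt1|_ -> //]; exact: (pullback_fun fg tt1 tt').
Qed.

(** [Delta] is computed on a chosen representative of a class. The iterated coproducts apply it to
    classes of explicit forests such as [delta_left t], and this lets the indices of those forests
    be used directly. *)
Lemma presents_Delta (R : realType) (N E : finType) (D : dforest L d N E) :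
  presents (Delta R d hi hU (iso_class D)) (@delta_weight R L d U N E D)
    (@delta_term L d i U hi hU N E D).
Proof.
have -> : Delta R d hi hU (iso_class D) = delta_series R hi hU D.
  exact/delta_series_iso/dforest_iso_sym/iso_class_repr.
exact: presents_delta.
Qed.

End Pullback.

Lemma forest_mul_class (L : finType) (d : nat) (N E N' E' : finType)
    (D : dforest L d N E) (D' : dforest L d N' E') :
  forest_mul (iso_class D) (iso_class D') = iso_class (dunion D D').
Proof.
apply/iso_classP/dforest_iso_sym.
have [f [g [[bf bg hs ht hty hc hec] hn ho he]]] := iso_class_repr D.
have [f' [g' [[bf' bg' hs' ht' hty' hc' hec'] hn' ho' he']]] := iso_class_repr D'.
have sum_bij (S S' T T' : Type) (u : S -> T) (u' : S' -> T') :
    bijective u -> bijective u' -> bijective (fun x : S + S' =>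
      match x with inl x => inl (u x) | inr x => inr (u' x) end).
  move=> [v uK vK] [v' uK' vK'].
  exists (fun x => match x with inl x => inl (v x) | inr x => inr (v' x) end);
    by case=> x; rewrite ?uK ?uK' ?vK ?vK'.
exists (fun x => match x with inl x => inl (f x) | inr x => inr (f' x) end).
exists (fun x => match x with inl x => inl (g x) | inr x => inr (g' x) end).
split; [|by case=> x /=|by case=> x /=|by case=> x /=].
split; by [exact: sum_bij|case=> x /=; rewrite ?hs ?ht ?hty ?hc ?hec ?hs' ?ht' ?hty' ?hc' ?hec'].
Qed.

(** * The Chu-Vandermonde identity *)

(* The truncated [m - p] would give [1] instead of [0] when [m < p]. *)
Definition binB (n m p : nat) : nat := if (p <= m)%N then 'C(n, m - p) else 0.

(** Absorbs a part of the subtracted amount into [m]; this splits off one summand in the induction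
    below. *)
Lemma binB_add n m p q : binB n m (q + p) = if (q <= m)%N then binB n (m - q) p else 0%N.
Proof.
rewrite /binB; case: leqP => h1; case: leqP => h2 //.
- by rewrite subnDA leq_subRL // h1.
- by have := leq_trans (leq_addr _ _) h1; rewrite leqNgt h2.
- by rewrite leq_subRL // leqNgt h1.
Qed.

Lemma binB_addl n p q : binB n (q + p) p = 'C(n, q).
Proof. by rewrite /binB leq_addl addnK. Qed.

(** After multiplication by [p! q!], both sides are the falling factorial of [n] of length
    [p + q]. *)
Lemma mul_bin_trinomial n p q :
  ('C(n, p) * 'C(n - p, q) = 'C(n, p + q) * 'C(p + q, p))%N.
Proof.
have pq0 : (0 < p`! * q`!)%N by rewrite muln_gt0 !fact_gt0.
apply/eqP; rewrite -(eqn_pmul2r pq0) mulnACA !bin_ffact -mulnA; apply/eqP.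
have := bin_fact (leq_addr q p); rewrite addKn => ->.
rewrite bin_ffact; elim: (q) => [|r IH]; first by rewrite addn0 muln1.
by rewrite addnS !ffactnSr mulnA IH subnDA.
Qed.

Section MultiVandermonde.
Local Open Scope nat_scope.
Variables (K J : finType) (s : J -> K) (b : J -> nat) (n : K -> nat) (M : nat).

(** Induction on the list [r] of the places where [c] may be nonzero. Fixing [c j0 = a] affects only
    the factor at [s j0], where [m] drops by [a]; the sum over [a] is then the ordinary Vandermonde
    identity there. The bound [M] makes [c] range over a finite type, large enough to contain all
    nonzero terms. *)
Lemma multi_Vandermonde_seq (r : seq J) (m : K -> nat) :
  uniq r -> (forall k, m k <= M) ->
  \sum_(c : {ffun J -> 'I_M.+1} | [forall j, (j \notin r) ==> (c j == ord0)])
    (\prod_(j <- r) 'C(b j, c j)) *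
    \prod_k binB (n k) (m k) (\sum_(j <- r | s j == k) c j) =
  \prod_k 'C(n k + \sum_(j <- r | s j == k) b j, m k).
Proof.
elim: r m => [|j0 r IH] m /=.
  move=> _ _; rewrite (big_pred1 [ffun=> ord0]) => [|c].
    rewrite big_nil mul1n; apply: eq_bigr => k _.
    by rewrite !big_nil /binB subn0 addn0.
  apply/forallP/eqP => [h|-> j]; last by rewrite ffunE eqxx.
  by apply/ffunP => j; rewrite ffunE; apply/eqP; exact: (h j).
move=> /andP[j0r ur] hm; rewrite (partition_big (fun c : {ffun J -> 'I_M.+1} => c j0) predT) //=.
have inner (a : 'I_M.+1) :
  \sum_(c : {ffun J -> 'I_M.+1} |
      [forall j, (j \notin j0 :: r) ==> (c j == ord0)] && (c j0 == a))
    (\prod_(j <- j0 :: r) 'C(b j, c j)) *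
    \prod_k binB (n k) (m k) (\sum_(j <- j0 :: r | s j == k) c j) =
  (\prod_(k | k != s j0) 'C(n k + \sum_(j <- r | s j == k) b j, m k)) *
  ('C(b j0, a) *
   if a <= m (s j0) then 'C(n (s j0) + \sum_(j <- r | s j == s j0) b j, m (s j0) - a) else 0).
  (* Resetting the value at [j0] to 0 identifies the functions with [c j0 = a] with those supported
     in [r]. *)
  pose upd (c : {ffun J -> 'I_M.+1}) (a' : 'I_M.+1) : {ffun J -> 'I_M.+1} :=
    [ffun j => if j == j0 then a' else c j].
  rewrite (reindex_onto (upd^~ a) (upd^~ ord0)) /=; last first.
    move=> c /andP[_ /eqP <-]; apply/ffunP => j; rewrite !ffunE.
    by case: eqP => [->|].
  under eq_bigl => c.
    rewrite (_ : _ && _ = [forall j, (j \notin r) ==> (c j == ord0)]); first over.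
    apply/andP/forallP => [[/andP[/forallP h _] /eqP <-] j|h].
      rewrite ffunE; have := h j; rewrite ffunE inE negb_or.
      by case: (j == j0) => //=; rewrite implybT.
    split; last first.
      apply/eqP/ffunP => j; rewrite !ffunE; case: eqP => // ->.
      by apply/esym/eqP; have := h j0; rewrite j0r.
    rewrite ffunE !eqxx andbT; apply/forallP => j; have := h j.
    by rewrite inE negb_or ffunE; case: (j == j0).
  have updE (c : {ffun J -> 'I_M.+1}) j : j \in r -> upd c a j = c j.
    by move=> jr; rewrite ffunE; case: eqP => // jj; rewrite -jj jr in j0r.
  transitivity (\sum_(c : {ffun J -> 'I_M.+1} |
        [forall j, (j \notin r) ==> (c j == ord0)])
      'C(b j0, a) * if a <= m (s j0) then (\prod_(j <- r) 'C(b j, c j)) *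
        \prod_k binB (n k) (m k - (s j0 == k) * a) (\sum_(j <- r | s j == k) c j)
      else 0).
    apply: eq_bigr => c _; rewrite big_cons {1}ffunE eqxx -mulnA; congr (_ * _).
    rewrite (eq_big_seq (fun j => 'C(b j, c j))); last by move=> j /updE ->.
    have sumE k : \sum_(j <- j0 :: r | s j == k) upd c a j =
        (s j0 == k) * a + \sum_(j <- r | s j == k) c j.
      rewrite big_cons {1}ffunE eqxx big_seq_cond.
      rewrite (eq_bigr (fun j => c j : nat)) -?big_seq_cond; first by case: eqP; rewrite ?mul1n.
      by move=> j /andP[/updE ->].
    under [X in _ * X = _]eq_bigr do rewrite sumE binB_add.
    case: ifP => am; last by rewrite (bigD1 (s j0)) //= eqxx mul1n am mul0n muln0.
    congr (_ * _); apply: eq_bigr => k _; case: eqP => [<-|_].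
      by rewrite mul1n am.
    by rewrite mul0n.
  rewrite -big_distrr /= mulnCA; congr (_ * _); case: ifP => am; last first.
    by rewrite big1 ?muln0.
  rewrite IH //; last by move=> k; apply: leq_trans (leq_subr _ _) (hm k).
  rewrite (bigD1 (s j0)) //= eqxx mul1n mulnC; congr (_ * _).
  by apply: eq_bigr => k; rewrite eq_sym => /negbTE ->; rewrite mul0n subn0.
under eq_bigr do rewrite inner.
rewrite -big_distrr /= [RHS](bigD1 (s j0)) //= mulnC; congr (_ * _); last first.
  by apply: eq_bigr => k kN; rewrite big_cons eq_sym (negbTE kN).
rewrite big_cons eqxx addnCA -binomial.Vandermonde.
(* Vandermonde gives a sum up to [m (s j0)], the other side runs to [M]; the additional terms are 0
   by the test [a <= m (s j0)]. *)
rewrite (big_ord_widen M.+1 (fun a => 'C(b j0, a) *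
  'C(n (s j0) + \sum_(j <- r | s j == s j0) b j, m (s j0) - a))) ?ltnS //.
rewrite [RHS]big_mkcond; apply: eq_bigr => a _ /=.
by rewrite ltnS; case: ifP; rewrite ?muln0.
Qed.

Lemma multi_Vandermonde (m : K -> nat) : (forall k, m k <= M) ->
  \sum_(c : {ffun J -> 'I_M.+1})
    (\prod_j 'C(b j, c j)) *
    \prod_k binB (n k) (m k) (\sum_(j | s j == k) c j) =
  \prod_k 'C(n k + \sum_(j | s j == k) b j, m k).
Proof.
move=> hm; rewrite -(multi_Vandermonde_seq (index_enum_uniq J) hm).
by apply: eq_bigl => c; apply/esym/forallP => j; rewrite mem_index_enum.
Qed.

End MultiVandermonde.

(** * The Vandermonde identity for vector-valued decorations of edges and nodes *)

Section EsumVandermonde.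
Variables (R : realType) (N E : finType) (d : nat).

Lemma esum_ffun_bounded (M : nat) (a : {ffun E -> Ndec d} -> R) :
  (forall c, 0 <= a c) -> (forall c, a c != 0 -> forall e l, (c e l <= M)%N) ->
  \esum_(c in [set: {ffun E -> Ndec d}]%classic) (a c)%:E =
  (\sum_(c : {ffun E * 'I_d -> 'I_M.+1}) a [ffun e => [ffun l => c (e, l) : nat]])%:E.
Proof.
move=> a0 aM.
pose i (c : {ffun E * 'I_d -> 'I_M.+1}) : {ffun E -> Ndec d} :=
  [ffun e => [ffun l => c (e, l) : nat]].
have i_inj : injective i.
  move=> c c' /ffunP cc'; apply/ffunP => -[e l]; have /ffunP/(_ l) := cc' e.
  by rewrite !ffunE => /val_inj.
rewrite (esumID (range i)) ?setTI; last by move=> c _; rewrite lee_fin.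
rewrite [X in (_ + X)%E]esum1 ?adde0; last first.
  move=> c /= nc; congr EFin; apply: contra_notP nc => /eqP /aM cM.
  exists [ffun el => inord (c el.1 el.2)] => //.
  by apply/ffunP => e; apply/ffunP => l; rewrite !ffunE /= inordK // ltnS.
rewrite esum_image; last by move=> c c' _ _; exact: i_inj.
rewrite esum_fset; [|exact: finite_finset|by move=> c _; rewrite lee_fin].
rewrite -sumEFin [RHS]bigfs ?index_enum_uniq => [|//|c _]; last by rewrite mem_index_enum.
by apply: eq_fsbigl; apply/seteqP.
Qed.

(** [multi_Vandermonde] is applied with edges and nodes paired with a coordinate [l], the pair
    [(e, l)] being sent to [(s e, l)]. *)
Lemma esum_Vandermonde (s : E -> N) (b : E -> Ndec d) (n m : N -> Ndec d) :
  \esum_(c in [set: {ffun E -> Ndec d}]%classic)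
    ((\prod_e \prod_l 'C(b e l, c e l))%N%:R *
     (\prod_x \prod_l binB (n x l) (m x l) ((\sum_(e | s e == x) c e)%R l))%N%:R : R)%:E =
  ((\prod_x \prod_l 'C(n x l + (\sum_(e | s e == x) b e)%R l, m x l))%N%:R : R)%:E.
Proof.
pose M := (\sum_x \sum_l m x l)%N.
have mM x l : (m x l <= M)%N by rewrite /M (bigD1 x) //= (bigD1 l) //= -addnA leq_addr.
rewrite (esum_ffun_bounded (M := M)); first last.
(* A nonzero [binB] at [s e] forces the sum of [c] over the edges with that source to be at most
   [m], which bounds [c e]. *)
- move=> c; rewrite mulf_eq0 negb_or => /andP[_]; rewrite pnatr_eq0 -lt0n => h e l.
  have := gt0_prodn (gt0_prodn h (s e) isT) l isT.
  rewrite /binB; case: ifP => // le_m _; apply: leq_trans (mM (s e) l).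
  apply: leq_trans le_m; rewrite (bigD1 e) //= ffunE leq_addr //.
- by move=> c; rewrite mulr_ge0.
congr EFin; under [LHS]eq_bigr do rewrite -natrM.
rewrite -natr_sum; congr (_%:R).
have sumE (f : E -> Ndec d) (xl : N * 'I_d) : (\sum_(e | s e == xl.1) f e) xl.2 =
    (\sum_(el : E * 'I_d | (s el.1, el.2) == xl) f el.1 el.2)%N.
  rewrite sum_ffunE -(pair_big_dep (fun e => s e == xl.1) (fun e l' => l' == xl.2)
    (fun e l' => f e l')) /=.
  by apply: eq_bigr => e _; rewrite big_pred1_eq.
rewrite pair_bigA /=; under [RHS]eq_bigr do rewrite sumE.
rewrite -(multi_Vandermonde _ _ _ (M := M)) //; apply: eq_bigr => c _.
rewrite !pair_bigA /=; congr (_ * _)%N.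
  by apply: eq_bigr => -[e l] _; rewrite !ffunE.
apply: eq_bigr => xl _; rewrite sumE; congr binB.
by apply: eq_bigr => -[e l] _; rewrite !ffunE.
Qed.

End EsumVandermonde.

(** * The two sides of Assumption 6 *)

Lemma inj_surj_bij (S T : Type) (f : S -> T) :
  injective f -> (forall y, exists x, f x = y) -> bijective f.
Proof.
move=> finj /boolp.choice[g gK]; exists g => // x.
by apply: finj; rewrite gK.
Qed.

(** Glues the part of [A] inside [B], which lives in the type of [B], to the part outside; it serves
    for nodes and for edges. *)
Lemma bij_sub_sum (T : finType) (A A1 B : {set T}) (A2 : {set {x | x \in B}}) :
  (forall x, (x \in A1) = (x \in A) && (x \notin B)) ->
  (forall u, (u \in A2) = (sval u \in A)) ->
  exists2 h : {u | u \in A2} + {x | x \in A1} -> {x | x \in A}, bijective h &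
    (forall u, sval (h (inl u)) = sval (sval u)) /\ (forall x, sval (h (inr x)) = sval x).
Proof.
move=> h1 h2.
have hl (u : {u | u \in A2}) : sval (sval u) \in A by rewrite -h2 (svalP u).
have hr (x : {x | x \in A1}) : sval x \in A by have := svalP x; rewrite h1 => /andP[].
exists (fun z => match z with
  | inl u => exist _ (sval (sval u)) (hl u) | inr x => exist _ (sval x) (hr x) end) => //.
have x1B (x : {x | x \in A1}) : sval x \notin B by have := svalP x; rewrite h1 => /andP[].
apply: inj_surj_bij => [[u|x] [u'|x'] /(congr1 (fun z => sval z)) /=|[x xA]].
- by move=> /val_inj /val_inj ->.
- by move=> e; have := x1B x'; rewrite -e (svalP (sval u)).
- by move=> e; have := x1B x; rewrite e (svalP (sval u')).
- by move=> /val_inj ->.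
have [xB|xB] := boolP (x \in B).
  have uA2 : exist _ x xB \in A2 by rewrite h2.
  by exists (inl (exist _ (exist _ x xB) uA2)); apply: val_inj.
have xA1 : x \in A1 by rewrite h1 xA.
by exists (inr (exist _ x xA1)); apply: val_inj.
Qed.

Section ExtendByZero.
Variables (T : finType) (B : {set T}) (V : nmodType) (h : {x | x \in B} -> V).

Definition ext0 (x : T) : V := oapp h 0 (insub x).

Lemma ext0_val u : ext0 (sval u) = h u.
Proof. by rewrite /ext0 valK. Qed.

Lemma ext0_out x : x \notin B -> ext0 x = 0.
Proof. by move=> xB; rewrite /ext0 insubN. Qed.

End ExtendByZero.

Lemma src_sum_restr (L N E : finType) (F : forest L N E) (B : subforest F)
    (V : nmodType) (h : sub_edge B -> V) (h' : E -> V) (u : sub_node B) :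
  (forall e, h e = h' (sval e)) ->
  src_sum (restr_forest B) h u =
  src_sum F (fun e => if e \in sedges B then h' e else 0) (sval u).
Proof.
move=> hh'; rewrite /src_sum -big_mkcondr /=.
rewrite (eq_bigl (fun e => (e \in sedges B) && (src F e == sval u))); last first.
  by move=> e; rewrite andbC.
rewrite (big_sub_cond (mem (sedges B)) (fun e => src F e == sval u)) /=.
by apply: eq_big => // e; rewrite -val_eqE.
Qed.

Section Assumption6.
Variables (L : finType) (i j : nat) (Ui Uj : sub_family L).
Hypotheses (hij : (i < j)%N) (hUi : assumption1 i Ui) (hUj : assumption1 j Uj)
  (h6 : assumption6 hUi hUj).
Variables (N E : finType) (F : cforest L N E).

(** In the recoloured forest the nodes of [B] have colour [j > i], and a subforest admissible for
    [i] avoids all colours above [i]. *)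
Lemma recol_disjoint (B : subforest F) (hB : B \in Uj F)
    (A1 : subforest (recol (a1_adm hUj hB))) x :
  A1 \in Ui (recol (a1_adm hUj hB)) -> x \in snodes A1 -> x \notin snodes B.
Proof.
move=> /(a1_adm hUi) [_ /(_ _ hij) dB _] xA1; apply/negP => xB.
have := disjointFl dB xA1; rewrite inE /= /recol_node xB eqxx andbT.
by rewrite (leq_trans _ hij).
Qed.

Lemma embed_node (B : subforest F) (A2 : subforest (restr F B)) (u : sub_node B) :
  (sval u \in snodes (embed A2)) = (u \in snodes A2).
Proof. by rewrite /snodes /= mem_imset //; exact: val_inj. Qed.

Lemma embed_edge (B : subforest F) (A2 : subforest (restr F B)) (e : sub_edge B) :
  (sval e \in sedges (embed A2)) = (e \in sedges A2).
Proof. by rewrite /sedges /= mem_imset //; exact: val_inj. Qed.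

Lemma embed_node_sub (B : subforest F) (A2 : subforest (restr F B)) x :
  x \in snodes (embed A2) -> x \in snodes B.
Proof. by move=> /imsetP[u _ ->]; exact: (svalP u). Qed.

Lemma embed_edge_sub (B : subforest F) (A2 : subforest (restr F B)) x :
  x \in sedges (embed A2) -> x \in sedges B.
Proof. by move=> /imsetP[u _ ->]; exact: (svalP u). Qed.

(** The equation [A = A1 + A2] solved for its two pieces, in terms of membership so that [embed]
    disappears from the matching argument below. *)
Definition splits (A B : subforest F) (A1 : subforest F) (A2 : subforest (restr F B)) :=
  [/\ forall x, (x \in snodes A1) = (x \in snodes A) && (x \notin snodes B),
      forall e, (e \in sedges A1) = (e \in sedges A) && (e \notin sedges B),
      forall u : sub_node B, (u \in snodes A2) = (sval u \in snodes A) &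
      forall e : sub_edge B, (e \in sedges A2) = (sval e \in sedges A)].

Lemma splits_union (B : subforest F) (hB : B \in Uj F)
    (A1 : subforest (recol (a1_adm hUj hB))) (A2 : subforest (restr F B)) :
  A1 \in Ui (recol (a1_adm hUj hB)) ->
  splits (sub_union (A1 : subforest F) (embed A2)) A1 A2.
Proof.
move=> hA1; have dA1 := recol_disjoint hA1.
have dE e : e \in sedges A1 -> e \notin sedges B.
  by move=> /(@src_sub _ _ _ (recol (a1_adm hUj hB)))/dA1; apply: contra => /src_sub.
split=> x; rewrite !inE.
- apply/idP/andP => [xA1|[/orP[//|/embed_node_sub ->//]]].
  by rewrite xA1 (dA1 _ xA1).
- apply/idP/andP => [xA1|[/orP[//|/embed_edge_sub ->//]]].
  by rewrite xA1 (dE _ xA1).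
- rewrite -embed_node orbC; case: (boolP (_ \in snodes (embed A2))) => //= _.
  by apply/esym/negP => /dA1; rewrite (svalP x).
- rewrite -embed_edge orbC; case: (boolP (_ \in sedges (embed A2))) => //= _.
  by apply/esym/negP => /dE; rewrite (svalP x).
Qed.

Lemma assumption6_split (A B : subforest F) (hA : A \in Ui F) :
  B \in Uj (recol (a1_adm hUi hA)) ->
  exists (hB : B \in Uj F) (A1 : subforest (recol (a1_adm hUj hB)))
    (A2 : subforest (restr F B)),
    [/\ A1 \in Ui (recol (a1_adm hUj hB)), A2 \in Ui (restr F B) & splits A A1 A2].
Proof.
move=> hB'; have [hB /imset2P[A1 A2 hA1 hA2 ->]] := (h6 A B).1 (ex_intro _ hA hB').
by exists hB, A1, A2; split => //; exact: (splits_union A2 hA1).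
Qed.

Lemma assumption6_union (B : subforest F) (hB : B \in Uj F)
    (A1 : subforest (recol (a1_adm hUj hB))) (A2 : subforest (restr F B)) :
  A1 \in Ui (recol (a1_adm hUj hB)) -> A2 \in Ui (restr F B) ->
  exists (A : subforest F) (hA : A \in Ui F),
    B \in Uj (recol (a1_adm hUi hA)) /\ splits A A1 A2.
Proof.
move=> hA1 hA2; exists (sub_union (A1 : subforest F) (embed A2)).
have [] := (h6 (sub_union (A1 : subforest F) (embed A2)) B).2.
  by exists hB; apply/imset2P; exists A1 A2.
by move=> hA hB'; exists hA; split=> //; exact: splits_union.
Qed.

End Assumption6.

(** * Matching the two sides *)

Section Decorations.
Variables (L : finType) (d : nat).

Lemma Z_of_ND (u v : Ndec d) : Z_of_N (u + v) = Z_of_N u + Z_of_N v.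
Proof. by apply/ffunP => l; rewrite !ffunE PoszD. Qed.

Lemma Ndec_addrI (u v w : Ndec d) : u + v = u + w -> v = w.
Proof.
move=> /ffunP h; apply/ffunP => l; have := h l.
by rewrite !ffunE => /addnI.
Qed.

Lemma Z_of_N_src_sum (N E : finType) (F : forest L N E) (h : E -> Ndec d) x :
  Z_of_N (src_sum F h x) = src_sum F (fun e => Z_of_N (h e)) x.
Proof. by apply: (big_morph (@Z_of_N d) Z_of_ND); exact: Z_of_N0. Qed.

Lemma src_sumD (N E : finType) (F : forest L N E) (V : nmodType) (h h' : E -> V) x :
  src_sum F h x + src_sum F h' x = src_sum F (fun e => h e + h' e) x.
Proof. by rewrite /src_sum big_split. Qed.

Lemma Zdec_of_ZD (u v : {ffun 'I_d -> int}) :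
  Zdec_of_Z L u + Zdec_of_Z L v = Zdec_of_Z L (u + v).
Proof. by congr pair; rewrite addr0. Qed.

Lemma delta_right_odec_out (U : sub_family L) (N E : finType) (D : dforest L d N E)
    (t : delta_index U D) x : x \notin snodes (ix_sub t) ->
  delta_right_odec t x = odec D x.
Proof.
move=> xA; rewrite /delta_right_odec ix_n_supp // Z_of_N0 /src_sum big1 ?addr0 //.
move=> e /eqP se; rewrite ix_eps_src ?se // Z_of_N0.
by case: ifP => [/src_sub|_]; rewrite ?subr0 // se (negbTE xA).
Qed.

End Decorations.

Section Matching.
Variables (L : finType) (d i j : nat) (Ui Uj : sub_family L).
Hypotheses (hi : (0 < i)%N) (hij : (i < j)%N) (hUi : assumption1 i Ui)
  (hUj : assumption1 j Uj) (h6 : assumption6 hUi hUj).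
Let hj : (0 < j)%N := ltn_trans hi hij.
Variables (N E : finType) (D : dforest L d N E).

Section Cut.
Variables (t : delta_index Uj D) (a : delta_index Ui D).

(* the decoration [eps_3] *)
Definition cut_eps (e : E) : Ndec d :=
  if (src D e \in snodes (ix_sub t)) && (e \notin sedges (ix_sub t)) then ix_eps a e else 0.

End Cut.

(** The left indices are [t], [s2], [s1], the right ones [a], [b]. The relations are solved for the
    left side, so that the right indices determine the left ones. *)
Record matches (t : delta_index Uj D) (s2 : delta_index Ui (delta_left t))
    (s1 : delta_index Ui (delta_right hj hUj t)) (a : delta_index Ui D)
    (b : delta_index Uj (delta_right hi hUi a)) : Prop := Matches {
  mt_splits : splits (F := D) (B := ix_sub t) (ix_sub a) (ix_sub s1) (ix_sub s2);
  mt_nodes : forall x, (x \in snodes (ix_sub b)) = (x \in snodes (ix_sub t));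
  mt_edges : forall e, (e \in sedges (ix_sub b)) = (e \in sedges (ix_sub t));
  mt_n : forall x, ix_n t x =
    (if x \in snodes (ix_sub t) then ix_n a x else 0) + ix_n b x;
  mt_eps : forall e, ix_eps t e = cut_eps t a e + ix_eps b e;
  mt_n2 : forall u : sub_node (ix_sub t),
    ix_n s2 u = ix_n a (sval u) + src_sum D (cut_eps t a) (sval u);
  mt_eps2 : forall e : sub_edge (ix_sub t), ix_eps s2 e = ix_eps a (sval e);
  mt_n1 : forall x, ix_n s1 x = if x \in snodes (ix_sub t) then 0 else ix_n a x;
  mt_eps1 : forall e, ix_eps s1 e =
    if src D e \in snodes (ix_sub t) then 0 else ix_eps a e }.

(** * Matching indices give the same three forests *)

Section Terms.
Variables (t : delta_index Uj D) (s2 : delta_index Ui (delta_left t))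
  (s1 : delta_index Ui (delta_right hj hUj t)) (a : delta_index Ui D)
  (b : delta_index Uj (delta_right hi hUi a)).
Hypothesis m : matches s2 s1 b.

(** The three positions of an edge relative to the subforest [B] of [t], each with the values that
    the decorations take there. A leaving edge starts at a node of [B] without belonging to [B]. *)
Variant edge_case (e : E) : Prop :=
| EdgeInside of e \in sedges (ix_sub t) & src D e \in snodes (ix_sub t) &
    ix_eps t e = 0 & ix_eps b e = 0 & ix_eps s1 e = 0 & cut_eps t a e = 0 &
    (e \in sedges (ix_sub s1)) = false
| EdgeLeaving of (e \in sedges (ix_sub t)) = false & src D e \in snodes (ix_sub t) &
    (e \in sedges (ix_sub a)) = false & (e \in sedges (ix_sub s1)) = false &
    ix_eps s1 e = 0 & cut_eps t a e = ix_eps a e & ix_eps t e = ix_eps a e + ix_eps b e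
| EdgeOutside of (e \in sedges (ix_sub t)) = false &
    (src D e \in snodes (ix_sub t)) = false & ix_eps t e = 0 & ix_eps b e = 0 &
    ix_eps s1 e = ix_eps a e & cut_eps t a e = 0 &
    (e \in sedges (ix_sub s1)) = (e \in sedges (ix_sub a)).

Lemma edge_caseP e : edge_case e.
Proof.
have [sn se _ _] := mt_splits m.
have [eB|eB] := boolP (e \in sedges (ix_sub t)).
  have sB := src_sub eB.
  apply: EdgeInside => //; first exact: ix_eps_in.
  - by apply: ix_eps_in; rewrite (mt_edges m) // eB.
  - by rewrite (mt_eps1 m) sB.
  - by rewrite /cut_eps eB andbF.
  - by rewrite se eB andbF.
have [sB|sB] := boolP (src D e \in snodes (ix_sub t)).
  have cE : cut_eps t a e = ix_eps a e by rewrite /cut_eps sB eB.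
  (* An edge of [s1] starts off [B]. Since [a] and [s1] have the same edges outside [B], a leaving
     edge is not in the subforest of [a] either. *)
  have e1 : (e \in sedges (ix_sub s1)) = false.
    by apply/negP => /(@src_sub _ _ _ (delta_right hj hUj t)); rewrite sn sB andbF.
  apply: EdgeLeaving => //; first exact: negbTE.
  - by rewrite -e1 se eB andbT.
  - by rewrite (mt_eps1 m) sB.
  - by rewrite -cE (mt_eps m).
apply: EdgeOutside => //; try exact: negbTE.
- exact: ix_eps_src.
- by apply: ix_eps_src; rewrite (mt_nodes m).
- by rewrite (mt_eps1 m) (negbTE sB).
- by rewrite /cut_eps (negbTE sB).
- by rewrite se eB andbT.
Qed.

Lemma src_sum_cut x : x \notin snodes (ix_sub t) -> src_sum D (cut_eps t a) x = 0.
Proof.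
by move=> xB; apply: big1 => e /eqP se; rewrite /cut_eps se (negbTE xB).
Qed.

Lemma ix_n_right_out x : x \notin snodes (ix_sub t) -> ix_n b x = 0.
Proof. by move=> xB; apply: ix_n_supp; rewrite (mt_nodes m). Qed.

(** The last tensor factor depends on the two node decorations only through their sum. The sums
    agree because [n_1] vanishes on [B] and equals [n_A] off [B]. *)
Lemma mt_n_sum x : ix_n t x + ix_n s1 x = ix_n a x + ix_n b x.
Proof.
rewrite (mt_n m) (mt_n1 m); case: ifPn => xB; first by rewrite addr0.
by rewrite add0r addrC.
Qed.

Lemma src_sum_eps x :
  src_sum D (ix_eps t) x = src_sum D (cut_eps t a) x + src_sum D (ix_eps b) x.
Proof. by rewrite src_sumD; apply: eq_bigr => e _; rewrite (mt_eps m). Qed.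

(** The parts of [A] inside and off [B] are glued. An edge starting in [B] lies in [B] or leaves it,
    so [pi eps_2] and [pi eps_3] add up to [pi eps_A]. Off [B], cutting out [B] changes neither the
    colours nor [o] on [A1], nor [e] on its edges, which start off [B]. *)
Lemma matches_left :
  forest_mul (iso_class (delta_left s2)) (iso_class (delta_left s1)) = iso_class (delta_left a).
Proof.
have [sn se sn2 se2] := mt_splits m.
rewrite forest_mul_class; apply/iso_classP.
have [f bf [fl fr]] := bij_sub_sum sn sn2.
have [g bg [gl gr]] := bij_sub_sum se se2.
exists f, g; split.
- split=> //.
  + by case=> e; apply: val_inj; rewrite /= ?gl ?gr ?fl ?fr.
  + by case=> e; apply: val_inj; rewrite /= ?gl ?gr ?fl ?fr.
  + by case=> e; rewrite /= ?gl ?gr.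
  + case=> x; rewrite /= ?fl ?fr //.
    by have := svalP x; rewrite sn /recol_node => /andP[_ /negbTE ->].
  + case=> e; rewrite /= ?gl ?gr //.
    by have := svalP e; rewrite se /recol_edge => /andP[_ /negbTE ->].
- case=> x /=; rewrite ?fl ?fr.
    rewrite (mt_n2 m) (src_sum_restr (h' := ix_eps a)); last exact: mt_eps2 m.
    rewrite -addrA; congr (_ + _); rewrite /src_sum -big_split /=.
    apply: eq_bigr => e /eqP es; case: (edge_caseP e).
    + by move=> -> _ _ _ _ -> _; rewrite add0r.
    + by move=> -> _ _ _ _ -> _; rewrite addr0.
    + by rewrite es (svalP (sval x)).
  have := svalP x; rewrite sn => /andP[_ xB].
  rewrite (mt_n1 m) (negbTE xB); congr (_ + _); apply: eq_bigr => e /eqP es.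
  by rewrite (mt_eps1 m) es (negbTE xB).
- case=> x /=; rewrite ?fl ?fr //.
  have := svalP x; rewrite sn => /andP[_ xB].
  by rewrite delta_right_odec_out.
- case=> e /=; rewrite ?gl ?gr //.
  rewrite /delta_right_edec.
  have := svalP e; case: (edge_caseP (sval e)).
  + by move=> _ _ _ _ _ _ ->.
  + by move=> _ _ _ ->.
  + by move=> -> _ -> _ _ _ _ _; rewrite addr0.
Qed.

(** Both factors live on [B], recoloured along [A]. In the decoration [o], the term [pi eps_3] of
    [n_2] supplies the edges leaving [B], which a sum taken inside [B] misses. *)
Lemma matches_middle : iso_class (delta_right hi hUi s2) = iso_class (delta_left b).
Proof.
have [sn se sn2 se2] := mt_splits m.
apply/iso_classP.
have [f bf fE] : exists2 f : sub_node (ix_sub t) -> sub_node (ix_sub b), bijective f &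
    forall u, sval (f u) = sval u.
  by apply: (bijective_sub (f := id) _ (mt_nodes m)); exists id.
have [g bg gE] : exists2 g : sub_edge (ix_sub t) -> sub_edge (ix_sub b), bijective g &
    forall e, sval (g e) = sval e.
  by apply: (bijective_sub (f := id) _ (mt_edges m)); exists id.
exists f, g; split.
- split=> //.
  + by move=> e; apply: val_inj; rewrite /= gE fE.
  + by move=> e; apply: val_inj; rewrite /= gE fE.
  + by move=> e; rewrite /= gE.
  + by move=> x; rewrite /= fE /recol_node sn2.
  + by move=> e; rewrite /= gE /recol_edge se2.
- move=> u; apply/ffunP => l; rewrite /= fE [RHS]ffunE.
  (* With [ix_n s2 u] as an explicit summand, the truncated subtraction cancels exactly. *)
  have -> : ndec (delta_left t) u =
      ix_n s2 u + (ix_n b (sval u) + src_sum D (ix_eps b) (sval u)).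
    by rewrite /= (mt_n m) (svalP u) src_sum_eps (mt_n2 m) addrACA.
  by rewrite [X in (X - _)%N]ffunE addKn.
- move=> u; rewrite /= fE /delta_right_odec /= -!addrA; congr (_ + _).
  rewrite !Zdec_of_ZD; congr Zdec_of_Z.
  rewrite (mt_n2 m) Z_of_ND -addrA; congr (_ + _).
  rewrite (src_sum_restr (h' := fun e => Z_of_N (ix_eps a e) -
     (if e \in sedges (ix_sub a) then Z_of_N (edec D e) else 0))); last first.
    by move=> e; rewrite (mt_eps2 m) se2.
  rewrite Z_of_N_src_sum src_sumD; apply: eq_bigr => e /eqP es.
  case: (edge_caseP e).
  + by move=> -> _ _ _ _ -> _; rewrite Z_of_N0 add0r.
  + by move=> -> _ -> _ _ -> _; rewrite subr0 addr0.
  + by rewrite es (svalP u).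
- by move=> e; rewrite /= gE /delta_right_edec se2 (mt_eps2 m).
Qed.

Lemma matches_right : iso_class (delta_right hi hUi s1) = iso_class (delta_right hj hUj b).
Proof.
have [sn se sn2 se2] := mt_splits m.
apply/iso_classP; exists id, id; split.
- split=> //; try by exists id.
  + move=> x; rewrite /= /recol_node (mt_nodes m) sn /= /recol_node.
    by case: (x \in snodes (ix_sub t)); rewrite ?andbF ?andbT.
  + move=> x; rewrite /= /recol_edge (mt_edges m) se /= /recol_edge.
    by case: (x \in sedges (ix_sub t)); rewrite ?andbF ?andbT.
- move=> x; apply/ffunP => l; rewrite !ffunE -!subnDA; congr (_ - _)%N.
  by have /ffunP/(_ l) := mt_n_sum x; rewrite !ffunE.
- move=> x; rewrite /= /delta_right_odec /= /delta_right_odec -!addrA; congr (_ + _).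
  rewrite !Zdec_of_ZD; congr Zdec_of_Z.
  have swap (p q r s : {ffun 'I_d -> int}) : p + (q + (r + s)) = (p + r) + (q + s).
    by rewrite addrA addrACA.
  rewrite !swap -!Z_of_ND mt_n_sum; congr (_ + _).
  rewrite !src_sumD; apply: eq_bigr => e _; rewrite (mt_edges m) /delta_right_edec.
  case: (edge_caseP e).
  (* On an edge of [B] outside [A], the amount [eps_A] added to [o] when [A] is cut out also enters
     the edge decoration, and is subtracted again when [B] is cut out. *)
  + move=> -> _ -> -> -> _ ->; rewrite !Z_of_N0 !sub0r oppr0 addr0 Z_of_ND.
    case: ifP => eA; first by rewrite ix_eps_in // !Z_of_N0 addr0 oppr0 addr0 sub0r.
    by rewrite subr0 opprD addrCA subrr addr0.
  + by move=> -> _ -> -> -> _ ->; rewrite !Z_of_N0 !subr0 addr0 Z_of_ND.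
  + move=> -> _ -> -> -> _ ->; rewrite !Z_of_N0 !subr0 addr0 add0r.
    by case: ifP; rewrite ?addr0.
- move=> e; rewrite /= /delta_right_edec /= /delta_right_edec (mt_edges m).
  case: (edge_caseP e).
  + by move=> -> _ -> -> -> _ ->; rewrite !addr0.
  + by move=> -> _ -> -> -> _ ->; rewrite addr0 addrA.
  + by move=> -> _ -> -> -> _ ->; rewrite !addr0; case: ifP.
Qed.

End Terms.

(** * The left indices as a function of the right ones *)

Lemma matches_inj (t t' : delta_index Uj D) (s2 : delta_index Ui (delta_left t))
    (s1 : delta_index Ui (delta_right hj hUj t)) (s2' : delta_index Ui (delta_left t'))
    (s1' : delta_index Ui (delta_right hj hUj t')) (a : delta_index Ui D)
    (b : delta_index Uj (delta_right hi hUi a)) :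
  matches s2 s1 b -> matches s2' s1' b ->
  existT (fun t => delta_index Ui (delta_left t) * delta_index Ui (delta_right hj hUj t))%type
    t (s2, s1) = existT _ t' (s2', s1').
Proof.
move=> m m'.
have nE x : (x \in snodes (ix_sub t)) = (x \in snodes (ix_sub t')).
  by rewrite -(mt_nodes m) (mt_nodes m').
have eE x : (x \in sedges (ix_sub t)) = (x \in sedges (ix_sub t')).
  by rewrite -(mt_edges m) (mt_edges m').
(* This equality comes first because the types of [s2] and [s1] depend on [t]. *)
have tt' : t = t'.
  apply: delta_index_eq; first exact: subforest_eq.
    by move=> x; rewrite (mt_n m) (mt_n m') nE.
  by move=> e; rewrite (mt_eps m) (mt_eps m') /cut_eps nE eE.
subst t'; have [sn se sn2 se2] := mt_splits m; have [sn' se' sn2' se2'] := mt_splits m'.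
suff [-> ->] : s2 = s2' /\ s1 = s1' by [].
split; apply: delta_index_eq.
- by apply: subforest_eq => x; rewrite ?sn2 ?sn2' ?se2 ?se2'.
- by move=> x; rewrite (mt_n2 m) (mt_n2 m').
- by move=> x; rewrite (mt_eps2 m) (mt_eps2 m').
- by apply: subforest_eq => x; rewrite ?sn ?sn' ?se ?se'.
- by move=> x; rewrite (mt_n1 m) (mt_n1 m').
- by move=> x; rewrite (mt_eps1 m) (mt_eps1 m').
Qed.

Lemma matches_ex (a : delta_index Ui D) (b : delta_index Uj (delta_right hi hUi a)) :
  exists (t : delta_index Uj D) (s2 : delta_index Ui (delta_left t))
    (s1 : delta_index Ui (delta_right hj hUj t)), matches s2 s1 b.
Proof.
(* [B] is made opaque so that it can later be replaced by the subforest of the index [t] built from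
   it, on which the types of the other indices depend. *)
pose B : subforest D := ix_sub b; have eB : ix_sub b = B by [].
clearbody B.
have bB : B \in Uj (recol (a1_adm hUi (ix_in a))) by rewrite -eB; exact: (ix_in b).
have [hB [A1 [A2 [hA1 hA2 sp]]]] := assumption6_split hij h6 bB.
pose cut e := if (src D e \in snodes B) && (e \notin sedges B) then ix_eps a e else 0.
have [||| t [tB tn te]] := @delta_index_ex _ _ Uj _ _ D B
  [ffun x => (if x \in snodes B then ix_n a x else 0) + ix_n b x]
  [ffun e => cut e + ix_eps b e] hB.
- move=> x xB; rewrite ffunE (negbTE xB) add0r; apply: ix_n_supp.
  by rewrite eB.
- move=> e eB'; rewrite ffunE /cut eB' andbF add0r; apply: ix_eps_in.
  by rewrite eB.
- move=> e eB'; rewrite ffunE /cut (negbTE eB') add0r; apply: ix_eps_src.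
  by rewrite eB.
move: eB; subst B; move=> eB.
(* The recoloured forest that contains [A1] depends on the proof of membership of [B]; the two
   proofs are identified. *)
have ehB := bool_irrelevance hB (ix_in t); subst hB.
have [sn se sn2 se2] := sp.
have [||| s2 [s2A s2n s2e]] := @delta_index_ex _ _ Ui _ _ (delta_left t) A2
  [ffun u => ix_n a (sval u) + src_sum D (cut_eps t a) (sval u)]
  [ffun e => ix_eps a (sval e)] hA2.
- move=> u; rewrite sn2 => uA; rewrite ffunE ix_n_supp // add0r.
  apply: big1 => e /eqP es; rewrite /cut_eps; case: ifP => // _.
  by rewrite ix_eps_src ?es.
- by move=> e; rewrite se2 => eA; rewrite ffunE ix_eps_in.
- by move=> e; rewrite sn2 => eA; rewrite ffunE ix_eps_src.
have [||| s1 [s1A s1n s1e]] := @delta_index_ex _ _ Ui _ _ (delta_right hj hUj t) A1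
  [ffun x => if x \in snodes (ix_sub t) then 0 else ix_n a x]
  [ffun e => if src D e \in snodes (ix_sub t) then 0 else ix_eps a e] hA1.
- move=> x; rewrite sn ffunE; case: ifP => // _; rewrite andbT; exact: ix_n_supp.
- by move=> e; rewrite se ffunE; case: ifP => // _ /andP[/ix_eps_in].
- move=> e; rewrite sn ffunE; case: ifP => // _; rewrite andbT; exact: (@ix_eps_src _ _ _ _ _ _ a e).
exists t, s2, s1; split.
- by rewrite s1A s2A.
- by move=> x; rewrite eB.
- by move=> x; rewrite eB.
- by move=> x; rewrite tn ffunE.
- by move=> x; rewrite te ffunE.
- by move=> x; rewrite s2n ffunE.
- by move=> x; rewrite s2e ffunE.
- by move=> x; rewrite s1n ffunE.
- by move=> x; rewrite s1e ffunE.
Qed.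

(** * The right indices that match given left ones *)

Section Fibre.
Variables (t : delta_index Uj D) (s2 : delta_index Ui (delta_left t))
  (s1 : delta_index Ui (delta_right hj hUj t)).

Definition node_ext : N -> Ndec d := ext0 (B := snodes (ix_sub t)) (fun u => ix_n s2 u).

Definition edge_ext : E -> Ndec d := ext0 (B := sedges (ix_sub t)) (fun e => ix_eps s2 e).

(** The conditions under which [eps_B' = eps_B - c], [n_A = n_2 - pi c] on [B] and
    [n_B' = n_B - n_A] make sense in the natural numbers. Outside this range the Vandermonde summand
    is 0. *)
Definition cut_range (c : E -> Ndec d) : Prop :=
  [/\ forall e l, (c e l <= ix_eps t e l)%N,
      forall x l, (src_sum D c x l <= node_ext x l)%N &
      forall x l, (node_ext x l - src_sum D c x l <= ix_n t x l)%N].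

Lemma matches_node_ext (a : delta_index Ui D) (b : delta_index Uj (delta_right hi hUi a)) :
  matches s2 s1 b -> forall x, node_ext x =
  (if x \in snodes (ix_sub t) then ix_n a x else 0) + src_sum D (cut_eps t a) x.
Proof.
move=> m x; case: ifPn => xB.
  by rewrite -[x]/(sval (exist _ x xB : sub_node (ix_sub t))) /node_ext ext0_val (mt_n2 m).
by rewrite /node_ext ext0_out // (src_sum_cut _ xB) addr0.
Qed.

Lemma matches_cut_range (a : delta_index Ui D) (b : delta_index Uj (delta_right hi hUi a)) :
  matches s2 s1 b -> cut_range (cut_eps t a).
Proof.
move=> m; split=> x l.
- by rewrite (mt_eps m) ffunE leq_addr.
- by rewrite (matches_node_ext m) ffunE leq_addl.
- by rewrite (matches_node_ext m) ffunE addnK (mt_n m) ffunE leq_addr.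
Qed.

(** [eps_A] is [eps_2] on the edges of [B], [eps_3] on those leaving [B] and [eps_1] elsewhere; [A]
    is recovered from its two pieces, and the remaining decorations by cancellation. *)
Lemma matches_fun (a a' : delta_index Ui D) (b : delta_index Uj (delta_right hi hUi a))
    (b' : delta_index Uj (delta_right hi hUi a')) :
  matches s2 s1 b -> matches s2 s1 b' -> cut_eps t a =1 cut_eps t a' ->
  existT (fun a => delta_index Uj (delta_right hi hUi a)) a b = existT _ a' b'.
Proof.
move=> m m' cE.
have sE x : src_sum D (cut_eps t a) x = src_sum D (cut_eps t a') x.
  by apply: eq_bigr => e _; rewrite cE.
have [sn se sn2 se2] := mt_splits m; have [sn' se' sn2' se2'] := mt_splits m'.
have aa' : a = a'.
  apply: delta_index_eq; first (apply: subforest_eq => x).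
  - have [xB|xB] := boolP (x \in snodes (ix_sub t)).
      by have := sn2' (exist _ x xB); rewrite sn2.
    by have := sn' x; rewrite sn xB !andbT.
  - have [xB|xB] := boolP (x \in sedges (ix_sub t)).
      by have := se2' (exist _ x xB); rewrite se2.
    by have := se' x; rewrite se xB !andbT.
  - move=> x; have [xB|xB] := boolP (x \in snodes (ix_sub t)).
      have := mt_n2 m' (exist _ x xB); rewrite (mt_n2 m) /= sE ![_ + src_sum _ _ _]addrC.
      exact: Ndec_addrI.
    by have := mt_n1 m' x; rewrite (mt_n1 m) (negbTE xB).
  - move=> e; have [eB|eB] := boolP (e \in sedges (ix_sub t)).
      by have := mt_eps2 m' (exist _ e eB); rewrite (mt_eps2 m).
    have [sB|sB] := boolP (src D e \in snodes (ix_sub t)).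
      by have := cE e; rewrite /cut_eps sB eB.
    by have := mt_eps1 m' e; rewrite (mt_eps1 m) (negbTE sB).
subst a'; suff -> : b = b' by [].
apply: delta_index_eq.
- by apply: subforest_eq => x; rewrite ?(mt_nodes m) ?(mt_nodes m') ?(mt_edges m) ?(mt_edges m').
- by move=> x; have := mt_n m' x; rewrite (mt_n m) => /Ndec_addrI.
- by move=> x; have := mt_eps m' x; rewrite (mt_eps m) => /Ndec_addrI.
Qed.

(** Each time an upper bound for [c] is 0: [eps_B] on the edges of [B] and on edges starting off
    [B], or [n_2] at the source of the edge. *)
Lemma cut_range_out (c : E -> Ndec d) : cut_range c ->
  (forall e, e \in sedges (ix_sub t) -> c e = 0) /\
  (forall e, node_ext (src D e) = 0 \/ src D e \notin snodes (ix_sub t) -> c e = 0).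
Proof.
move=> [h1 h2 _]; split=> e.
  move=> eB; apply/ffunP => l; apply/eqP; rewrite ffunE -leqn0.
  by have := h1 e l; rewrite ix_eps_in // ffunE.
case=> he; apply/ffunP => l; apply/eqP; rewrite ffunE -leqn0.
  have := h2 (src D e) l; rewrite he ffunE; apply: leq_trans.
  by rewrite /src_sum sum_ffunE (bigD1 e) //= leq_addr.
by have := h1 e l; rewrite ix_eps_src // ffunE.
Qed.

(** The relations of [matches] are solved for the right indices with [eps_3 = c]; Assumption 6
    supplies [A] from its two pieces. *)
Lemma cut_range_ex (c : E -> Ndec d) : cut_range c ->
  exists (a : delta_index Ui D) (b : delta_index Uj (delta_right hi hUi a)),
    matches s2 s1 b /\ cut_eps t a =1 c.
Proof.
move=> cP; have [c_in c_src] := cut_range_out cP; have [c_le pc_le nt_le] := cP.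
have [A [hA [hB sp]]] := assumption6_union hij h6 (ix_in s1) (ix_in s2).
have [sn se sn2 se2] := sp.
have nA_out x : x \notin snodes A -> node_ext x = 0.
  have [xB|xB] := boolP (x \in snodes (ix_sub t)); last by rewrite /node_ext ext0_out.
  rewrite -[x]/(sval (exist _ x xB : sub_node (ix_sub t))) /node_ext ext0_val -sn2.
  exact: ix_n_supp.
have eA_in e : e \in sedges (ix_sub t) -> (e \in sedges A) || (src D e \notin snodes A) ->
    edge_ext e = 0.
  move=> eB; rewrite -[e]/(sval (exist _ e eB : sub_edge (ix_sub t))) /edge_ext ext0_val -se2.
  move=> /orP[|sA]; first exact: ix_eps_in.
  by apply: ix_eps_src; rewrite sn2.
have [||| a [aA an ae]] := @delta_index_ex _ _ Ui _ _ D A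
  [ffun x => if x \in snodes (ix_sub t) then [ffun l => node_ext x l - src_sum D c x l]%N
             else ix_n s1 x]
  [ffun e => if e \in sedges (ix_sub t) then edge_ext e
             else if src D e \in snodes (ix_sub t) then c e else ix_eps s1 e] hA.
- move=> x xA; rewrite ffunE; case: ifPn => xB.
    by apply/ffunP => l; rewrite !ffunE nA_out // ffunE.
  by apply: ix_n_supp; rewrite sn (negbTE xA).
- move=> e eA; rewrite ffunE; case: ifPn => eB; first by rewrite eA_in ?eA.
  have e1 : e \in sedges (ix_sub s1) by rewrite se eA.
  have := @src_sub _ _ _ (delta_right hj hUj t) _ _ e1.
  by rewrite sn => /andP[_ /negbTE ->]; exact: (@ix_eps_in _ _ _ _ _ _ s1 e).
- move=> e sA; rewrite ffunE; case: ifPn => eB; first by rewrite eA_in ?sA ?orbT.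
  case: ifPn => sB; first by rewrite c_src // nA_out //; left.
  by apply: (@ix_eps_src _ _ _ _ _ _ s1 e); rewrite sn (negbTE sA).
subst A; have ehA := bool_irrelevance hA (ix_in a); subst hA.
have nA_le x l : ((if x \in snodes (ix_sub t) then ix_n a x else 0%R) l <= ix_n t x l)%N.
  by case: ifP => xB; rewrite ?an ffunE // xB ffunE.
have [||| b [bB bn be]] := @delta_index_ex _ _ Uj _ _ (delta_right hi hUi a) (ix_sub t)
  [ffun x => [ffun l => ix_n t x l - (if x \in snodes (ix_sub t) then ix_n a x else 0%R) l]%N]
  [ffun e => [ffun l => ix_eps t e l - c e l]%N] hB.
- by move=> x xB; apply/ffunP => l; rewrite !ffunE ix_n_supp // ffunE.
- by move=> x xB; apply/ffunP => l; rewrite !ffunE ix_eps_in // ffunE.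
- by move=> x xB; apply/ffunP => l; rewrite !ffunE ix_eps_src // ffunE.
have cutE e : cut_eps t a e = c e.
  rewrite /cut_eps ae ffunE; case: ifPn => [/andP[-> /negbTE ->] //|].
  rewrite negb_and negbK => /orP[sB|eB]; apply/esym; last exact: c_in.
  by apply: c_src; right.
exists a, b; split=> //; split=> //.
- by rewrite bB.
- by rewrite bB.
- by move=> x; apply/ffunP => l; rewrite bn !ffunE; exact/esym/subnKC.
- by move=> e; apply/ffunP => l; rewrite be cutE !ffunE; exact/esym/subnKC.
- move=> u; apply/ffunP => l; rewrite an !ffunE (svalP u) ffunE.
  have -> : src_sum D (cut_eps t a) (sval u) = src_sum D c (sval u).
    by apply: eq_bigr => e _; rewrite cutE.
  by rewrite -[ix_n s2 u](ext0_val (fun v => ix_n s2 v) u); exact/esym/subnK.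
- by move=> e; rewrite ae ffunE (svalP e) /edge_ext ext0_val.
- move=> x; rewrite an ffunE.
  have [xB|] := boolP (x \in snodes (ix_sub t)); last by [].
  by apply: (@ix_n_supp _ _ _ _ _ _ s1 x); rewrite sn xB andbF.
- move=> e; rewrite ae ffunE; have [sB|sB] := boolP (src D e \in snodes (ix_sub t)).
    by apply: (@ix_eps_src _ _ _ _ _ _ s1 e); rewrite sn sB andbF.
  by case: ifP => // /src_sub; rewrite (negbTE sB).
Qed.

(** * Comparison of the weights on a fibre *)

Variable R : realType.

(** The left weight without the binomial coefficients that choose [n_2]: the common factor of both
    sides, independent of [eps_3]. *)
Definition fibre_weight : R :=
  (\prod_e \prod_l ((ix_eps t e l)`! * (edge_ext e l)`! * (ix_eps s1 e l)`!))%N%:R^-1 *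
  (\prod_x \prod_l ('C(ndec D x l, ix_n t x l) *
     'C(ndec D x l - ix_n t x l, ix_n s1 x l)))%N%:R.

Lemma fibre_weight_ge0 : 0 <= fibre_weight.
Proof. by rewrite mulr_ge0 ?invr_ge0. Qed.

(** Products over [B] become products over the whole forest, since the extensions by zero only add
    factors [0! = 1] and [C(_, 0) = 1]. *)
Lemma left_weight : delta_weight R t * (delta_weight R s2 * delta_weight R s1) =
  fibre_weight * (\prod_x \prod_l 'C(ix_n t x l + src_sum D (ix_eps t) x l, node_ext x l))%N%:R.
Proof.
have s2E : (\prod_e \prod_l (ix_eps s2 e l)`! = \prod_e \prod_l (edge_ext e l)`!)%N.
  rewrite [RHS](bigID (mem (sedges (ix_sub t)))) /= [X in (_ * X)%N]big1 ?muln1.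
    rewrite (big_sub (mem (sedges (ix_sub t))) (fun e => \prod_l (edge_ext e l)`!)%N) /=.
    by apply: eq_bigr => e _; rewrite /edge_ext ext0_val.
  by move=> e eB; rewrite big1 // => l _; rewrite /edge_ext ext0_out // ffunE.
have s2N : (\prod_u \prod_l 'C(ndec (delta_left t) u l, ix_n s2 u l) =
    \prod_x \prod_l 'C(ix_n t x l + src_sum D (ix_eps t) x l, node_ext x l))%N.
  rewrite [RHS](bigID (mem (snodes (ix_sub t)))) /= [X in (_ * X)%N]big1 ?muln1.
    rewrite (big_sub (mem (snodes (ix_sub t)))
      (fun x => \prod_l 'C(ix_n t x l + src_sum D (ix_eps t) x l, node_ext x l))%N) /=.
    by apply: eq_bigr => u _; apply: eq_bigr => l _; rewrite /node_ext ext0_val ffunE.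
  by move=> x xB; rewrite big1 // => l _; rewrite /node_ext ext0_out // ffunE bin0.
have s1N : (\prod_x \prod_l 'C(ndec (delta_right hj hUj t) x l, ix_n s1 x l) =
    \prod_x \prod_l 'C(ndec D x l - ix_n t x l, ix_n s1 x l))%N.
  by apply: eq_bigr => x _; apply: eq_bigr => l _; rewrite ffunE.
have edgesE : (\prod_e \prod_l ((ix_eps t e l)`! * (edge_ext e l)`! * (ix_eps s1 e l)`!) =
    (\prod_e \prod_l (ix_eps t e l)`!) * (\prod_e \prod_l (edge_ext e l)`!) *
    (\prod_e \prod_l (ix_eps s1 e l)`!))%N.
  by rewrite -!big_split; apply: eq_bigr => e _; rewrite -!big_split.
have nodesE : (\prod_x \prod_l ('C(ndec D x l, ix_n t x l) *
      'C(ndec D x l - ix_n t x l, ix_n s1 x l)) =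
    (\prod_x \prod_l 'C(ndec D x l, ix_n t x l)) *
    (\prod_x \prod_l 'C(ndec D x l - ix_n t x l, ix_n s1 x l)))%N.
  by rewrite -!big_split; apply: eq_bigr => x _; rewrite -!big_split.
rewrite /delta_weight /fibre_weight s2E s2N s1N edgesE nodesE !natrM !invfM.
ring.
Qed.

(** On an edge leaving [B], [eps_B = eps_A + eps_B'], so the factor [C(eps_B, eps_3)] trades the
    factorials of [eps_A] and [eps_B'] for that of [eps_B]. At a node of [B], [binB] equals
    [C(n_B, n_A)] and the trinomial identity applies; off [B], [n_1 = n_A] and [n_B' = 0]. *)
Lemma matches_weight (a : delta_index Ui D) (b : delta_index Uj (delta_right hi hUi a)) :
  matches s2 s1 b -> delta_weight R a * delta_weight R b =
  fibre_weight * ((\prod_e \prod_l 'C(ix_eps t e l, cut_eps t a e l))%N%:R *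
    (\prod_x \prod_l binB (ix_n t x l) (node_ext x l) (src_sum D (cut_eps t a) x l))%N%:R).
Proof.
move=> m.
have edgesE : ((\prod_e \prod_l (ix_eps a e l)`!) * (\prod_e \prod_l (ix_eps b e l)`!) *
    (\prod_e \prod_l 'C(ix_eps t e l, cut_eps t a e l)) =
    \prod_e \prod_l ((ix_eps t e l)`! * (edge_ext e l)`! * (ix_eps s1 e l)`!))%N.
  rewrite -!big_split; apply: eq_bigr => e _ /=; rewrite -!big_split /=.
  apply: eq_bigr => l _; case: (edge_caseP m e).
  + move=> eB _ -> -> -> -> _; rewrite !ffunE bin0 !muln1 mul1n.
    rewrite -{2}[e]/(sval (exist _ e eB : sub_edge (ix_sub t))) /edge_ext ext0_val.
    by rewrite (mt_eps2 m).
  + move=> eB _ _ _ -> -> ->; rewrite /edge_ext ext0_out ?eB // !ffunE !muln1.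
    by rewrite mulnC -(bin_fact (leq_addr (ix_eps b e l) (ix_eps a e l))) addKn.
  + move=> eB _ -> -> -> -> _; rewrite /edge_ext ext0_out ?eB // !ffunE.
    by rewrite bin0 !muln1 !mul1n.
have nodesE : ((\prod_x \prod_l 'C(ndec D x l, ix_n a x l)) *
    (\prod_x \prod_l 'C(ndec D x l - ix_n a x l, ix_n b x l)) =
    (\prod_x \prod_l ('C(ndec D x l, ix_n t x l) * 'C(ndec D x l - ix_n t x l, ix_n s1 x l))) *
    \prod_x \prod_l binB (ix_n t x l) (node_ext x l) (src_sum D (cut_eps t a) x l))%N.
  rewrite -!big_split; apply: eq_bigr => x _ /=; rewrite -!big_split /=.
  apply: eq_bigr => l _.
  rewrite (_ : binB _ _ _ =
    'C(ix_n t x l, (if x \in snodes (ix_sub t) then ix_n a x else 0%R) l)); last first.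
    by rewrite (matches_node_ext m) [X in binB _ X _]ffunE; exact: binB_addl.
  have [xB|xB] := boolP (x \in snodes (ix_sub t)).
    have -> : ix_n t x l = (ix_n a x l + ix_n b x l)%N by rewrite (mt_n m) xB ffunE.
    by rewrite (mt_n1 m) xB ffunE bin0 muln1 mul_bin_trinomial.
  rewrite (mt_n m) (mt_n1 m) (negbTE xB) add0r (ix_n_right_out m xB) ffunE.
  by rewrite !bin0 subn0 mul1n.
have bE : (\prod_x \prod_l 'C(ndec (delta_right hi hUi a) x l, ix_n b x l) =
    \prod_x \prod_l 'C(ndec D x l - ix_n a x l, ix_n b x l))%N.
  by apply: eq_bigr => x _; apply: eq_bigr => l _; rewrite ffunE.
have inv_nat (p q r : nat) : (0 < r)%N -> (p * q = r)%N -> p%:R^-1 = r%:R^-1 * q%:R :> R.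
  move=> r0 pq; rewrite -pq natrM invfM -mulrA mulVf ?mulr1 //.
  by rewrite pnatr_eq0; case: q pq r0 => [|//]; rewrite muln0 => <-.
rewrite /delta_weight bE mulrACA -invfM -!natrM nodesE (inv_nat _ _ _ _ edgesE).
  by rewrite !natrM /fibre_weight; ring.
by do 2 (apply: prodn_gt0 => ?); rewrite !muln_gt0 !fact_gt0.
Qed.

(** Vandermonde expands the left weight into a sum over [c]. Its nonzero terms lie in [cut_range],
    and taking [eps_3] is a bijection from the fibre onto this range. *)
Lemma fibre_sum :
  (delta_weight R t * (delta_weight R s2 * delta_weight R s1))%:E =
  \esum_(k in [set k : {a : delta_index Ui D & delta_index Uj (delta_right hi hUi a)} |
      matches s2 s1 (tagged k)]%classic)
    (delta_weight R (tag k) * delta_weight R (tagged k))%:E.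
Proof.
pose W (c : {ffun E -> Ndec d}) : R := (\prod_e \prod_l 'C(ix_eps t e l, c e l))%N%:R *
    (\prod_x \prod_l binB (ix_n t x l) (node_ext x l) (src_sum D c x l))%N%:R.
have W0 c : 0 <= W c by rewrite mulr_ge0.
have F0 := fibre_weight_ge0.
rewrite left_weight EFinM -(esum_Vandermonde R (src D)) -esumZ //.
rewrite (esumID [set c : {ffun E -> Ndec d} | cut_range c]%classic) ?setTI; last first.
  by move=> c _; rewrite lee_fin mulr_ge0.
rewrite [X in (_ + X)%E]esum1 ?adde0; last first.
  move=> c /= nc; congr EFin; apply: contra_notP nc => /eqP.
  rewrite -/(W c) mulf_eq0 negb_or => /andP[_]; rewrite mulf_eq0 negb_or.
  rewrite !pnatr_eq0 -!lt0n => /andP[hE hN].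
  have hN' x l := gt0_prodn (gt0_prodn hN x isT) l isT.
  split=> [e l|x l|x l].
  - by have := gt0_prodn (gt0_prodn hE e isT) l isT; rewrite bin_gt0.
  - by have := hN' x l; rewrite /binB; case: ifP.
  - by have := hN' x l; rewrite /binB; case: ifP => // _; rewrite bin_gt0.
pose cut (k : {a : delta_index Ui D & delta_index Uj (delta_right hi hUi a)}) :
  {ffun E -> Ndec d} := [ffun e => cut_eps t (tag k) e].
rewrite (@reindex_esum _ _ _ [set k | matches s2 s1 (tagged k)]%classic _ cut).
  apply: eq_esum => -[a b] /= m; congr EFin; rewrite (matches_weight m); congr (_ * (_ * _%:R)).
    by congr (_%:R); apply: eq_bigr => e _; apply: eq_bigr => l _; rewrite ffunE.
  apply: eq_bigr => x _; apply: eq_bigr => l _.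
  rewrite (eq_bigr (cut_eps t a)) // => e _; exact: ffunE.
split.
- move=> [a b] /= /matches_cut_range; rewrite /cut /=.
  rewrite (_ : [ffun e => _] = cut_eps t a :> (E -> _)) //.
  by apply/funext => e; rewrite ffunE.
- move=> [a b] [a' b'] /set_mem /= m /set_mem /= m' /ffunP cE.
  by apply: matches_fun m m' _ => e; have := cE e; rewrite !ffunE.
- move=> c /= /cut_range_ex[a [b [m cE]]]; exists (existT _ a b) => //.
  by apply/ffunP => e; rewrite ffunE /= cE.
Qed.

End Fibre.
End Matching.

(** * Both sides presented over explicit indices and compared fibre by fibre *)

Theorem proposition3p27 (R : realType) (L : finType) (d : nat) (hd : (0 < d)%N)
    (i j : nat) (hi : (0 < i)%N) (hij : (i < j)%N)
    (Ui Uj : sub_family L)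
    (hUi : assumption1 i Ui) (hUj : assumption1 j Uj)
    (h6 : assumption6 hUi hUj) :
  let Delta_i := Delta R d hi hUi in
  let Delta_j := Delta R d (ltn_trans hi hij) hUj in
  forall tau : decforest L d,
    extend (mul13 R L d) (extend (tensor Delta_i Delta_i) (Delta_j tau)) =
    extend (tensor (tid R (decforest L d)) Delta_j) (Delta_i tau).
Proof.
move=> Delta_i Delta_j tau; set D := repr tau.
have lhs1 := presents_extend (f := tensor Delta_i Delta_i)
  (presents_delta R (ltn_trans hi hij) hUj D)
  (fun t => presents_tensor (x := delta_term (ltn_trans hi hij) hUj t)
    (presents_Delta hi hUi R (delta_left t))
    (presents_Delta hi hUi R (delta_right (ltn_trans hi hij) hUj t))).
(* [mul13] sends basis elements to basis elements, so it only adds a component of type [unit] to the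
   index. *)
have lhs := presents_extend (f := mul13 R L d) lhs1 (fun k => presents_pure _ _ _).
have rhs := presents_extend (f := tensor (tid R (decforest L d)) Delta_j)
  (presents_delta R hi hUi D)
  (fun a => presents_tid_tensor (x := delta_term hi hUi a)
    (presents_Delta (ltn_trans hi hij) hUj R (delta_right hi hUi a))).
(* The right indices are grouped by the left index that they match. *)
apply: (presents_fibres lhs rhs
  (J := fun k k' => matches (tagged (tag k)).1 (tagged (tag k)).2 (tagged k'))).
- move=> [[t [s2 s1]] []] [[t' [s2' s1']] []] [a b] /= m m'.
  by rewrite (matches_inj m m').
- move=> [a b]; have [t [s2 [s1 m]]] := matches_ex hij h6 b.
  by exists (existT _ (existT _ t (s2, s1)) tt).
- move=> [[t [s2 s1]] []] [a b] /= m; rewrite /mul13_fun /=.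
  by rewrite (matches_left m) (matches_middle m) (matches_right m).
- by move=> [[t [s2 s1]] []] /=; rewrite mulr1; apply: fibre_sum.
Qed.
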